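(* Let $Y$ be a random variable with values in $\mathbb R_+=(0,\infty)$. Then there exist an odometer $(X,\mathcal B,m,T)$ with $m(X)=1$, an increasing, $1$-regularly varying function $b:\mathbb R_+\to\mathbb R_+$ and a positive measurable function $f:X\to\mathbb R_+$ such that $$\frac1{b(n)}\sum_{k=0}^{n-1}f\circ T^k\ \longrightarrow\ Y\quad\text{strongly in distribution as } n\to\infty,$$ and such that there exist $M>1$, $r>0$ and $N_0\ge1$ with $$m\Big(\Big[\sum_{k=0}^{n-1}f\circ T^k<x\,b(n)\Big]\Big)\le \mathrm{Prob}(Y\le Mx)\qquad\forall\ x\in(0,r),\ n\ge N_0 .$$
   Context: $\mathbb R_+=(0,\infty)$. A function $b:\mathbb R_+\to\mathbb R_+$ is $\gamma$-regularly varying if $b(xt)/b(t)\to x^\gamma$ as $t\to\infty$ for every $x>0$. Strong distributional convergence: for a measure space $(X,\mathcal B,m)$, a metric space $Z$, measurable $F_n:X\to Z$ and a $Z$-valued random variable $Y$, $F_n$ converges strongly in distribution to $Y$ if for every probability measure $Q$ on $(X,\mathcal B)$ with $Q\ll m$, one has $\int_X g(F_n)\,dQ\to E(g(Y))$ for every bounded continuous $g:Z\to\mathbb R$. Odometers: a column (Rokhlin tower) is a finite sequence $W=(I_1,\dots,I_h)$ of disjoint intervals of $\mathbb R$ of equal length; its base is $B(W)=I_1$, its top is $A(W)=I_h$, its union is $U(W)=\bigcup_k I_k$, and $T_W:U(W)\to U(W)$ is the map translating $I_k$ onto $I_{k+1}$ ($1\le k\le h-1$) and $I_h$ onto $I_1$.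 A Rokhlin tower $W'$ refines $W$ (mass preservingly) if $U(W')=U(W)$, each interval of $W$ is a union of intervals of $W'$, $A(W')\subset A(W)$, $B(W')\subset B(W)$, and $T_{W'}=T_W$ on $U(W)\setminus A(W)$. An odometer is a transformation $(X,\mathcal B,m,T)$ obtained from a sequence $(W_n)_{n\ge1}$ of Rokhlin towers, each $W_{n+1}$ refining $W_n$ in this sense, with $m(A(W_n))\to0$, where $X=U(W_1)$, $\mathcal B$ is the Borel $\sigma$-algebra, $m$ is Lebesgue measure and $T(x)=\lim_{n\to\infty}T_{W_n}(x)$ for $m$-a.e. $x$. *)

(* Defs.v *)
From HB Require Import structures.
From mathcomp Require Import all_boot all_order all_algebra.
From mathcomp Require Import all_classical all_reals all_analysis.

Set Implicit Arguments.
Unset Strict Implicit.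
Unset Printing Implicit Defensive.

Import Order.TTheory GRing.Theory Num.Theory.
Import numFieldNormedType.Exports.

Local Open Scope classical_set_scope.
Local Open Scope ring_scope.

Definition regularly_varying (R : realType) (gamma : R) (b : R -> R) : Prop :=
  (forall t, 0 < t -> 0 < b t) /\
  (forall x, 0 < x -> b (x * t) / b t @[t --> +oo] --> x `^ gamma).

(* Strong distributional convergence of the [F n], seen as measurable maps from
   the measure space [(D, m)] to the metric space [Z], a subset of the line, to
   the [Z]-valued random variable [Y].
   A probability on [D] is a probability [Q] on the ambient space with
   [Q D = 1]; for such a [Q], absolute continuity with respect to [m] and to the
   restriction of [m] to [D] are the same.  The test functions are continuous on
   [Z] only, and their values off [Z] are irrelevant as soon as [F n] maps [D]
   to [Z] for all large [n] and [Y] takes its values in [Z]. *)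
Definition strong_cvg_in_distribution (R : realType)
    (d : measure_display) (T : measurableType d)
    (m : {measure set T -> \bar R}) (D : set T) (Z : set R) (F : nat -> T -> R)
    (d' : measure_display) (Omega : measurableType d') (P : probability Omega R)
    (Y : {RV P >-> R}) : Prop :=
  forall Q : probability T R, Q D = 1%E -> Q `<< m ->
  forall g : R -> R, {within Z, continuous g} ->
    (exists C : R, forall z, Z z -> `|g z| <= C) ->
  (\int[Q]_(x in D) (g (F n x))%:E)%E @[n --> \oo] --> ('E_P[g \o Y])%E.

(* The interval with endpoints [a] and [a + w]; [lc] and [rc] say whether it is
   closed on the left and on the right. *)
Definition segment (R : realType) (lc rc : bool) (w a : R) : set R :=
  [set` Interval (BSide lc a) (BSide (~~ rc) (a + w))].

(* A Rokhlin tower.  Its levels are translates of one another, hence share their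
   length and the nature of their endpoints. *)
Record tower (R : realType) := Tower {
  tower_top_index : nat;
  tower_left : 'I_tower_top_index.+1 -> R;
  tower_width : R;
  tower_lclosed : bool;
  tower_rclosed : bool;
  tower_width_gt0 : 0 < tower_width;
  tower_disjoint : trivIset setT
    (fun k => segment tower_lclosed tower_rclosed tower_width (tower_left k))
}.

Section Tower.
Variables (R : realType) (W : tower R).

Local Notation level_index := 'I_(tower_top_index W).+1.

Definition tower_level (k : level_index) : set R :=
  segment (tower_lclosed W) (tower_rclosed W) (tower_width W) (tower_left k).

Definition tower_base : set R := tower_level ord0.

Definition tower_top : set R := tower_level ord_max.

Definition tower_union : set R := \bigcup_k tower_level k.

(* [ordS] is the cyclic successor; the value off [tower_union] is a junk value. *)
Definition tower_map (x : R) : R :=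
  if [pick k : level_index | x \in tower_level k] is Some k
  then x - tower_left k + tower_left (ordS k) else x.

End Tower.

Definition refines (R : realType) (W' W : tower R) : Prop :=
  [/\ tower_union W' = tower_union W,
      forall k, exists K : set 'I_(tower_top_index W').+1,
        tower_level (W := W) k = \bigcup_(j in K) tower_level j,
      tower_top W' `<=` tower_top W,
      tower_base W' `<=` tower_base W &
      {in tower_union W `\` tower_top W, tower_map W' =1 tower_map W}].

(* [X] carries the Borel sigma-algebra and Lebesgue measure, and the values of
   [T] off [X] are irrelevant.  As the limit determines [T] only almost
   everywhere, it is required separately that [T] be a measurable self-map of
   [X]. *)
Definition is_odometer (R : realType) (X : set R) (T : R -> R) : Prop :=
  [/\ measurable_fun X T, (forall x, X x -> X (T x)) &
      exists W : nat -> tower R,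
      [/\ forall n, refines (W n.+1) (W n),
          lebesgue_measure (tower_top (W n)) @[n --> \oo] --> 0%E,
          X = tower_union (W 0%N) &
          {ae lebesgue_measure, forall x, X x ->
             tower_map (W n) x @[n --> \oo] --> T x}]].

Definition birkhoff_sum (R : realType) (T f : R -> R) (n : nat) (x : R) : R :=
  \sum_(k < n) f (iter k T x).

(* Main.v *)
Require Import Defs.
From HB Require Import structures.
From mathcomp Require Import all_boot all_order all_algebra.
From mathcomp Require Import all_classical all_reals all_analysis.
From mathcomp Require Import measurable_realfun.
From mathcomp Require Import zify ring lra.

Set Implicit Arguments.
Unset Strict Implicit.
Unset Printing Implicit Defensive.

Import Order.TTheory GRing.Theory Num.Theory.
Import numFieldNormedType.Exports.

Local Open Scope classical_set_scope.
Local Open Scope ring_scope.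

(* The odometer is the adding machine on [0, 1) for the mixed radix 2, 3, 4, ...,
   whose towers have heights h_n = (n + 1)!.  Fix v with the law of Y under
   Lebesgue measure.  The state y_l at level l is an independent copy of v
   (truncated at a slowly growing cap) if the l-th digit vanishes, which has
   probability 1 / (l + 2), and is y_(l + 1) otherwise; it is thus constant along
   the orbit segments inside the tower of level l, and its law tends to that of Y.
   The function f puts the mass c_j h_j y_j on the top of the tower of level j for
   every j, where c_j sums up to a slowly varying sequence L, and b(t) = t L(k) for
   h_k <= t < h_(k + 1).

   Most points x do not reach the top of the tower of level k + 2 within N steps,
   h_k <= N < h_(k + 1).  Then S_N f(x) differs from N L(k) y_(k + 2)(x) by the
   contribution of the renewed states, whose mean is at most a constant times
   N sum_(l < k) cap(l) L(l) / (l + 2) = o(N L(k)), and by smaller boundary terms.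
   So S_N f / b(N) is close in measure to y_(k + 2), whose law is nearly that of Y.
   The limit also holds under any density, because a function which is constant
   along the segments of a high tower is nearly independent of a continuous one.

   For the lower tail there is no room for an error in measure.  But half of the
   orbit segment of length N lies in the (k + 1)-block of its midpoint, where f,
   after the first k-block, dominates y_(k + 1) times a deterministic function of
   the position whose mean is at least L(k) / 2; hence S_N f(x) is at least a fixed
   multiple of b(N) y_(k + 1)(T^p x), and the law of y_(k + 1) is at most that of Y
   near 0. *)

(** * Mixed radix expansions *)

Section Coordinates.
Context {R : realType}.
Implicit Types (x u : R) (n t : nat).

Definition height n : nat := (n.+1)`!.

Lemma height_gt0 n : (0 < height n)%N.
Proof. exact: fact_gt0. Qed.

Lemma heightS n : height n.+1 = (n.+2 * height n)%N.
Proof. by rewrite /height factS. Qed.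

Lemma height_ge n : (n < height n)%N.
Proof. by elim: n => // n IH; rewrite heightS; nia. Qed.

Lemma dvdn_height m n : (m <= n)%N -> (height m %| height n)%N.
Proof. by move=> mn; rewrite /height (@fact_split n.+1 m.+1)// dvdn_mulr. Qed.

Lemma leq_height m n : (m <= n)%N -> (height m <= height n)%N.
Proof. by move=> mn; rewrite dvdn_leq ?height_gt0// dvdn_height. Qed.

(* [tail n x] is the fractional part of [h_n x]: the digits of [x] of index at least
   [n], so that [x = left_end n (position n x) + tail n x / h_n]. *)
Fixpoint tail n x : R :=
  if n is n'.+1 then n'.+2%:R * tail n' x - (Num.truncn (n'.+2%:R * tail n' x))%:R
  else x.

Definition digit n x : nat := Num.truncn (n.+2%:R * tail n x).

Fixpoint position n x : nat :=
  if n is n'.+1 then (position n' x + height n' * digit n' x)%N else 0%N.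

(** The digits of [t] are read in reverse: the digit of weight h_j in [t] gets weight 1 / h_(j + 1)
    on the line. This is the left end of level [t] of the tower of height h_n. *)
Fixpoint left_end n t : R :=
  if n is n'.+1 then
    left_end n' (t %% height n')%N + (t %/ height n')%:R / (height n'.+1)%:R
  else 0.

Lemma tailS n x : tail n.+1 x = n.+2%:R * tail n x - (digit n x)%:R.
Proof. by []. Qed.

Lemma tail_itv n x : 0 <= x < 1 -> 0 <= tail n x < 1.
Proof.
move=> x01; elim: n => // n /andP[u0 u1]; rewrite tailS /digit.
have /truncn_itv/andP[] : 0 <= n.+2%:R * tail n x by rewrite mulr_ge0.
by rewrite -natr1 => *; apply/andP; split; lra.
Qed.

Lemma digit_lt n x : 0 <= x < 1 -> (digit n x < n.+2)%N.
Proof.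
move=> /(tail_itv n)/andP[u0 u1].
by rewrite truncn_lt_nat ?mulr_ge0// gtr_pMr.
Qed.

Lemma position_lt n x : 0 <= x < 1 -> (position n x < height n)%N.
Proof.
move=> x01; elim: n => //= n IH; have := digit_lt n x01.
by rewrite heightS; nia.
Qed.

Lemma position_mod n x : 0 <= x < 1 ->
  (position n.+1 x %% height n = position n x)%N.
Proof. by move=> x01 /=; rewrite addnC mulnC modnMDl modn_small ?position_lt. Qed.

Lemma position_div n x : 0 <= x < 1 ->
  (position n.+1 x %/ height n = digit n x)%N.
Proof.
by move=> x01 /=; rewrite addnC mulnC divnMDl ?height_gt0// divn_small ?position_lt ?addn0.
Qed.

Lemma position_modm m n x : 0 <= x < 1 -> (m <= n)%N ->
  (position n x %% height m = position m x)%N.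
Proof.
move=> x01; elim: n => [|n IH]; first by rewrite leqn0 => /eqP->.
rewrite leq_eqVlt => /orP[/eqP->|]; first by rewrite modn_small ?position_lt.
rewrite ltnS => mn; rewrite -IH// -[in RHS](position_mod n x01) modn_dvdm//.
exact: dvdn_height.
Qed.

Lemma heightR_gt0 n : 0 < (height n)%:R :> R.
Proof. by rewrite ltr0n height_gt0. Qed.

Lemma heightR_neq0 n : (height n)%:R != 0 :> R.
Proof. by rewrite gt_eqF ?heightR_gt0. Qed.

Lemma left_end_position n x : 0 <= x < 1 ->
  x = left_end n (position n x) + tail n x / (height n)%:R.
Proof.
move=> x01; elim: n => [|n IH]; first by rewrite /= add0r divr1.
rewrite tailS [left_end _ _]/= -/(position n.+1 x).
rewrite position_mod// position_div// [LHS]IH heightS natrM.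
have : n.+2%:R != 0 :> R by [].
by move: n.+2%:R => q q0; field; rewrite heightR_neq0.
Qed.

(** Converse of [left_end_position]: position and tail can be prescribed freely. The induction
    splits off the last digit of [t] and moves it into the tail. *)
Lemma coordinatesP n t u : (t < height n)%N -> 0 <= u < 1 ->
  let x := left_end n t + u / (height n)%:R in
  [/\ 0 <= x < 1, position n x = t & tail n x = u].
Proof.
elim: n t u => [|n IH] t u tn u01 x.
  by rewrite /x /= add0r divr1; split=> //; case: (t) tn.
have dt : (t %/ height n < n.+2)%N by rewrite ltn_divLR ?height_gt0// -heightS.
(* [u'] is the tail at level [n] whose first digit is [d] and whose next tail is [u]. *)
pose d := (t %/ height n)%N; pose u' := (d%:R + u) / n.+2%:R.
have n2 : 0 < n.+2%:R :> R by rewrite ltr0n.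
have u'01 : 0 <= u' < 1.
  have : d.+1%:R <= n.+2%:R :> R by rewrite ler_nat.
  rewrite -natr1 => ?; have : 0 <= d%:R :> R by [].
  by move=> ?; rewrite /u' ler_pdivlMr// ltr_pdivrMr//; lra.
have tm : (t %% height n < height n)%N by rewrite ltn_mod height_gt0.
have [x01 px ux] := IH _ _ tm u'01.
have xE : x = left_end n (t %% height n) + u' / (height n)%:R.
  rewrite /x /u' /= heightS natrM -/d.
  have : n.+2%:R != 0 :> R by [].
  by move: n.+2%:R => q q0; field; rewrite heightR_neq0.
have nu : n.+2%:R * tail n x = d%:R + u by rewrite xE ux /u' mulrC divfK// gt_eqF.
have dx : digit n x = d.
  rewrite /digit nu; apply: truncn_def; rewrite -natr1; lra.
split; first by rewrite xE.
  by rewrite /= dx xE px /d [RHS](divn_eq t (height n)) mulnC addnC.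
by rewrite tailS nu dx addrC addKr.
Qed.

Lemma left_end0 n : left_end n 0 = 0.
Proof. by elim: n => //= n IH; rewrite mod0n div0n IH mul0r addr0. Qed.

(** All digits are maximal; digit j contributes (j + 1) / h_(j + 1) = 1 / h_j - 1 / h_(j + 1), and
    the sum telescopes. *)
Lemma left_end_last n : left_end n (height n).-1 = 1 - (height n)%:R^-1.
Proof.
elim: n => [|n IH]; first by rewrite /= invr1 subrr.
have hn := height_gt0 n.
have E : (height n.+1).-1 = (n.+1 * height n + (height n).-1)%N.
  by rewrite heightS; nia.
rewrite [left_end _ _]/= E modnMDl divnMDl// modn_small ?prednK// divn_small ?prednK//.
rewrite IH addn0 heightS natrM (_ : n.+1%:R = n.+2%:R - 1); last first.
  by rewrite -(natr1 n.+1) addrK.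
have : n.+2%:R != 0 :> R by [].
by move: n.+2%:R => q q0; field; rewrite heightR_neq0.
Qed.

(** The top level is the rightmost one, so the number of maximal leading digits can be read off from
    the distance of [x] to 1. *)
Lemma position_topP n x : 0 <= x < 1 ->
  (position n x == (height n).-1) = (1 - (height n)%:R^-1 <= x).
Proof.
move=> x01; have h0 := heightR_gt0 n; apply/eqP/idP => [px|xge].
  rewrite [leRHS](left_end_position n x01) px left_end_last lerDl.
  by have /andP[? _] := tail_itv n x01; rewrite divr_ge0// ltW.
pose u := (x - (1 - (height n)%:R^-1)) * (height n)%:R.
have u01 : 0 <= u < 1.
  rewrite /u mulr_ge0 ?subr_ge0// ?ltW//=.
  rewrite -ltr_pdivlMr// mul1r; lra.
have hl : ((height n).-1 < height n)%N by rewrite prednK// height_gt0.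
have [_] := coordinatesP hl u01.
by rewrite left_end_last /u mulfK ?heightR_neq0// addrCA subrr addr0.
Qed.

End Coordinates.

(** * The adding machine *)

Section AddingMachine.
Context {R : realType}.
Implicit Types (x t : R) (m n k : nat).

(* The largest [n] with [height n <= m], for [0 < m]. *)
Fixpoint level m : nat :=
  if m is m'.+1 then
    if (height (level m').+1 <= m)%N then (level m').+1 else level m'
  else 0%N.

Lemma level_itv m : (0 < m)%N ->
  (height (level m) <= m < height (level m).+1)%N.
Proof.
case: m => // m _; elim: m => [//|m /andP[h1 h2]].
have E : level m.+2 = if (height (level m.+1).+1 <= m.+2)%N then (level m.+1).+1
  else level m.+1 by [].
rewrite E; case: ifPn => [h3|]; last by rewrite -ltnNge => ->; rewrite (leq_trans h1).
rewrite h3 /=; have := height_gt0 (level m.+1).+1.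
by rewrite (heightS (level m.+1).+1); nia.
Qed.

(** The index k with h_k <= t < h_(k + 1) when t >= 1. It serves the norming function and, at t = 1
    / (1 - x), the counting of carries. *)
Definition scale t : nat := level (Num.truncn t).

Lemma height_le_scale t n : 1 <= t -> ((height n)%:R <= t) = (n <= scale t)%N.
Proof.
move=> t1; have t0 : 0 <= t by rewrite (le_trans ler01).
have /level_itv/andP[h1 h2] : (0 < Num.truncn t)%N by rewrite truncn_gt0.
rewrite -truncn_ge_nat//; apply/idP/idP => [hn|/leq_height hn]; last first.
  exact: leq_trans hn h1.
rewrite leqNgt; apply/negP => /leq_height hn'.
by move: (leq_trans h2 hn'); rewrite ltnNge hn.
Qed.

Lemma scale_itv t : 1 <= t ->
  (height (scale t))%:R <= t < (height (scale t).+1)%:R.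
Proof. by move=> t1; rewrite ltNge !height_le_scale// leqnn ltnn. Qed.

Lemma scale_lt1 t : t < 1 -> scale t = 0%N.
Proof.
by move=> t1; rewrite /scale (_ : Num.truncn t = 0%N)//; apply/truncn0Pn; rewrite -ltNge.
Qed.

Lemma le_scale s t : s <= t -> (scale s <= scale t)%N.
Proof.
move=> st; have [s1|s1] := ltP s 1; first by rewrite scale_lt1.
rewrite -height_le_scale ?(le_trans s1)//.
by apply: le_trans st; have /andP[] := scale_itv s1.
Qed.

(* The number of leading digits of [x] that are maximal, hence reset by a carry. *)
Definition carry x : nat := scale (1 - x)^-1.

Lemma carryP x n : 0 <= x < 1 ->
  (1 - (height n)%:R^-1 <= x) = (n <= carry x)%N.
Proof.
move=> /andP[x0 x1]; rewrite /carry -height_le_scale; last first.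
  by rewrite invr_ge1 ?unitfE; lra.
rewrite -[X in X <= (1 - x)^-1]invrK lef_pV2 ?posrE ?invr_gt0 ?heightR_gt0 ?subr_gt0//.
by rewrite lerBlDl addrC -lerBlDl.
Qed.

(** With m = [carry x], resetting the m maximal digits subtracts 1 - 1 / h_m, and raising digit m by
    one adds 1 / h_(m + 1). *)
Definition odo x : R :=
  x - 1 + (height (carry x))%:R^-1 + (height (carry x).+1)%:R^-1.

Lemma odo_carry x : 0 <= x < 1 ->
  let m := carry x in
  [/\ 0 <= odo x < 1, position m (odo x) = 0%N &
      tail m (odo x) = tail m x + m.+2%:R^-1].
Proof.
move=> x01 m.
have pm : position m x = (height m).-1.
  by apply/eqP; rewrite position_topP// carryP.
have xE := left_end_position m x01; rewrite pm left_end_last in xE.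
have hm := @heightR_gt0 R m; have m2 : 0 < m.+2%:R :> R by [].
(* Digit m is not maximal, so adding one to it causes no further carry. *)
have ult : tail m x < 1 - m.+2%:R^-1.
  have : ~~ (1 - (height m.+1)%:R^-1 <= x) by rewrite carryP// ltnn.
  rewrite -ltNge [X in X < _]xE heightS natrM invfM.
  have hV : 0 < (height m)%:R^-1 :> R by rewrite invr_gt0.
  move=> h; rewrite -(ltr_pM2r hV) mulrBl mul1r; move: h.
  by rewrite -addrA ltrD2l addrC ltrBlDr addrC.
have /andP[u0 _] := tail_itv m x01.
have u01 : 0 <= tail m x + m.+2%:R^-1 < 1.
  by rewrite addr_ge0 ?invr_ge0//= -ltrBrDr.
have [] := coordinatesP (height_gt0 m) u01.
suff -> : left_end m 0 + (tail m x + m.+2%:R^-1) / (height m)%:R = odo x by [].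
rewrite left_end0 /odo -/m [in RHS]xE heightS natrM.
have : m.+2%:R != 0 :> R by [].
by move: m.+2%:R => q q0; field; rewrite gt_eqF.
Qed.

Lemma odo_itv x : 0 <= x < 1 -> 0 <= odo x < 1.
Proof. by move=> /odo_carry[]. Qed.

Lemma odo_top x n : 0 <= x < 1 -> (n <= carry x)%N -> position n (odo x) = 0%N.
Proof.
move=> x01 nm; have [y01 pm _] := odo_carry x01.
by rewrite -(position_modm y01 nm) pm mod0n.
Qed.

(** The carry is absorbed by the digit of index [carry x]; all later digits are untouched. The
    induction on [n] starts just above the carry. *)
Lemma odo_ntop x n : 0 <= x < 1 -> (carry x < n)%N ->
  position n (odo x) = (position n x).+1 /\ tail n (odo x) = tail n x.
Proof.
move=> x01; elim: n => // n IH; rewrite ltnS leq_eqVlt => /orP[/eqP cn|cn]; last first.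
  have [p t] := IH cn.
  by rewrite !tailS /= /digit t p addSn.
have [y01 pm tm] := odo_carry x01; rewrite cn in pm tm.
have px : position n x = (height n).-1.
  by apply/eqP; rewrite position_topP// carryP// cn.
have n2 : n.+2%:R * n.+2%:R^-1 = 1 :> R by rewrite mulfV.
have dn : digit n (odo x) = (digit n x).+1.
  rewrite /digit tm mulrDr n2; apply: truncn_def.
  have /truncn_itv : 0 <= n.+2%:R * tail n x.
    by rewrite mulr_ge0//; have /andP[] := tail_itv n x01.
  rewrite -/(digit n x) -!natr1; lra.
split; first by rewrite /= pm px dn; have := height_gt0 n; nia.
by rewrite !tailS tm dn mulrDr n2 -natr1; ring.
Qed.

Lemma position_odo x n : 0 <= x < 1 ->
  position n (odo x) = ((position n x).+1 %% height n)%N.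
Proof.
move=> x01; have [nm|mn] := leqP n (carry x).
  rewrite odo_top//; move: nm; rewrite -carryP// -position_topP// => /eqP ->.
  by rewrite prednK ?height_gt0// modnn.
have [p _] := odo_ntop x01 mn; rewrite p modn_small// -p position_lt//.
exact: odo_itv.
Qed.

Lemma carry_lt x n : 0 <= x < 1 -> ((position n x).+1 < height n)%N ->
  (carry x < n)%N.
Proof.
move=> x01 pn; rewrite ltnNge -carryP// -position_topP//; apply/negP => /eqP.
by move: pn; have := height_gt0 n; lia.
Qed.

Lemma iter_odo_itv i x : 0 <= x < 1 -> 0 <= iter i odo x < 1.
Proof. by move=> x01; elim: i => //= i; exact: odo_itv. Qed.

Lemma position_iter x n i : 0 <= x < 1 ->
  position n (iter i odo x) = ((position n x + i) %% height n)%N.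
Proof.
move=> x01; elim: i => [|i IH]; first by rewrite addn0 modn_small ?position_lt.
by rewrite iterS position_odo ?iter_odo_itv// IH -addn1 modnDml addn1 addnS.
Qed.

End AddingMachine.

(** * The towers of the adding machine *)

Section Odometer.
Context {R : realType}.
Implicit Types (x : R) (n : nat).

Definition unit_itv : set R := `[0, 1[%classic.

Lemma unit_itvE x : unit_itv x = (0 <= x < 1) :> Prop.
Proof. by rewrite /unit_itv /= in_itv. Qed.

(** On this interval [odo] is a translation, so measurability and invariance can be checked piece by
    piece. *)
Definition carry_set n : set R :=
  `[1 - (height n)%:R^-1, 1 - (height n.+1)%:R^-1[%classic.

Lemma carry_setP n x : carry_set n x <-> unit_itv x /\ carry x = n.
Proof.
rewrite unit_itvE /carry_set /= in_itv /=; split=> [/andP[h1 h2]|[x01 <-]].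
  have x01 : 0 <= x < 1.
    rewrite (le_trans _ h1) ?subr_ge0 ?invf_le1 ?heightR_gt0 ?ler1n ?height_gt0//=.
    by rewrite (lt_le_trans h2)// lerBlDr lerDl.
  split=> //; apply/eqP; rewrite eqn_leq -(carryP n x01) h1 andbT leqNgt.
  by rewrite -carryP// -ltNge.
by rewrite ltNge !carryP// leqnn ltnn.
Qed.

Lemma bigcup_carry_set : \bigcup_n carry_set n = unit_itv.
Proof.
apply/seteqP; split=> [x [n _ /carry_setP[]]//|x X].
by exists (carry x) => //; apply/carry_setP.
Qed.

Lemma measurable_carry_set n : measurable (carry_set n).
Proof. exact: measurable_itv. Qed.

Lemma odo_carry_set n : {in carry_set n,
  odo =1 fun x => x + (- 1 + (height n)%:R^-1 + (height n.+1)%:R^-1)}.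
Proof. by move=> x /[!inE] /carry_setP[_ <-]; rewrite /odo; ring. Qed.

Lemma measurable_odo : measurable_fun unit_itv (@odo R).
Proof.
rewrite -bigcup_carry_set; apply/measurable_fun_bigcup => n.
  exact: measurable_carry_set.
apply: eq_measurable_fun (fun x H => esym (odo_carry_set H)) _.
by apply: measurable_funD => //; exact: measurable_cst.
Qed.

Lemma segment_left_end n t x : (t < height n)%N ->
  segment true false (height n)%:R^-1 (left_end n t) x <->
  unit_itv x /\ position n x = t.
Proof.
move=> tn; rewrite unit_itvE /segment /= in_itv /=; split=> [/andP[h1 h2]|[x01 <-]].
  pose u := (x - left_end n t) * (height n)%:R.
  have u01 : 0 <= u < 1.
    rewrite /u mulr_ge0 ?subr_ge0//= -ltr_pdivlMr ?heightR_gt0// mul1r.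
    by rewrite ltrBlDl.
  have [] := coordinatesP tn u01.
  by rewrite /u mulfK ?heightR_neq0// addrC subrK.
have /andP[u0 u1] := tail_itv n x01.
have hV : 0 < (height n)%:R^-1 :> R by rewrite invr_gt0 heightR_gt0.
rewrite [X in _ <= X < _](left_end_position n x01) lerDl ltrD2l.
by rewrite mulr_ge0 ?(ltW hV)//= gtr_pMl.
Qed.

Lemma ltn_height_index n (k : 'I_(height n).-1.+1) : (k < height n)%N.
Proof. by have := ltn_ord k; rewrite [X in (_ < X)%N]prednK ?height_gt0. Qed.

Lemma adding_tower_disjoint n : trivIset setT
  (fun k : 'I_(height n).-1.+1 =>
     segment true false (height n)%:R^-1 (left_end n k : R)).
Proof.
move=> i j _ _ [x [/segment_left_end -/(_ (ltn_height_index i))[_ pi]]].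
move=> /segment_left_end -/(_ (ltn_height_index j))[_ pj].
by apply: val_inj; rewrite /= -pi -pj.
Qed.

Lemma heightV_gt0 n : 0 < (height n)%:R^-1 :> R.
Proof. by rewrite invr_gt0 heightR_gt0. Qed.

Definition adding_tower n : tower R := Tower (heightV_gt0 n) (@adding_tower_disjoint n).

Lemma adding_levelP n (k : 'I_(height n).-1.+1) x :
  tower_level (W := adding_tower n) k x <-> unit_itv x /\ position n x = k.
Proof. exact: segment_left_end (ltn_height_index k). Qed.

Lemma adding_tower_union n : tower_union (adding_tower n) = unit_itv.
Proof.
apply/seteqP; split=> [x [k _ /adding_levelP[]]//|x X].
have pn : (position n x < (height n).-1.+1)%N.
  by rewrite prednK ?height_gt0// position_lt// -unit_itvE.
by exists (Ordinal pn) => //; apply/adding_levelP.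
Qed.

Lemma adding_tower_top n x : tower_top (adding_tower n) x <->
  unit_itv x /\ (n <= carry x)%N.
Proof.
split=> [/adding_levelP[X /eqP]|[X nc]].
  by rewrite unit_itvE in X *; rewrite position_topP// carryP.
apply/adding_levelP; split=> //; apply/eqP.
by rewrite unit_itvE in X; rewrite position_topP// carryP.
Qed.

Lemma adding_tower_topE n :
  tower_top (adding_tower n) = `[1 - (height n)%:R^-1, 1[%classic.
Proof.
apply/seteqP; split=> x; rewrite adding_tower_top unit_itvE /= in_itv /=.
  by move=> [x01]; rewrite -carryP// => ->; case/andP: x01.
move=> /andP[h1 h2]; have x01 : 0 <= x < 1.
  by rewrite h2 (le_trans _ h1)// subr_ge0 invf_le1 ?heightR_gt0// ler1n height_gt0.
by rewrite -carryP.
Qed.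

(** Off the top both maps raise the position by one and keep the tail. *)
Lemma adding_tower_map n x : unit_itv x -> (carry x < n)%N ->
  tower_map (adding_tower n) x = odo x.
Proof.
move=> X cn; rewrite /tower_map; case: pickP => [k|nok]; last first.
  move: (X); rewrite -(adding_tower_union n) => -[k _ kx].
  by have := nok k; rewrite mem_set.
rewrite inE => /adding_levelP[_ pk]; rewrite unit_itvE in X.
have [po to] := odo_ntop X cn.
rewrite [RHS](left_end_position n (odo_itv X)) po to.
rewrite [X in X - _ + _](left_end_position n X) pk /=.
rewrite modn_small; first by ring.
by rewrite ltnS -pk -ltnS prednK ?height_gt0// -po position_lt// odo_itv.
Qed.

(** The tower of height h_n is cut into n + 2 columns, which are stacked from left to right; the new
    level [j] lies in the old level [j] modulo h_n. *)
Lemma adding_tower_refines n : refines (adding_tower n.+1) (adding_tower n).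
Proof.
split.
- by rewrite !adding_tower_union.
- move=> k; exists (fun j => (j %% height n)%N = k).
  apply/seteqP; split=> x.
    move=> /adding_levelP[X px]; have X' := X; rewrite unit_itvE in X'.
    have pn : (position n.+1 x < (height n.+1).-1.+1)%N.
      by rewrite prednK ?height_gt0// position_lt.
    exists (Ordinal pn); first by rewrite -px -(position_mod n X').
    exact/adding_levelP.
  move=> [j jk /adding_levelP[X pj]]; apply/adding_levelP; split=> //.
  by rewrite unit_itvE in X; rewrite -(position_mod n X) pj.
- move=> x /adding_tower_top[X nc]; apply/adding_tower_top; split=> //.
  exact: ltnW.
- move=> x /adding_levelP[X px]; apply/adding_levelP; split=> //.
  by rewrite unit_itvE in X; rewrite -(position_mod n X) px /= mod0n.
- move=> x /[!inE] -[]; rewrite adding_tower_union => X ntop.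
  have cn : (carry x < n)%N.
    by rewrite ltnNge; apply/negP => nc; apply/ntop/adding_tower_top.
  by rewrite !adding_tower_map// ltnS ltnW.
Qed.

Lemma lebesgue_top n :
  lebesgue_measure (`[1 - (height n)%:R^-1, 1[%classic : set R) = (height n)%:R^-1%:E.
Proof.
rewrite lebesgue_measure_itv/= lte_fin ltrBlDr ltrDl heightV_gt0.
by rewrite -EFinB opprB addrC subrK.
Qed.

Lemma cvg_heightV : (height n)%:R^-1 @[n --> \oo] --> (0 : R).
Proof.
apply: (@squeeze_cvgr _ _ _ _ (cst 0) (fun n => n.+1%:R^-1)) => //.
- near=> n; rewrite invr_ge0 ler0n/= lef_pV2 ?posrE ?heightR_gt0//.
  by rewrite ler_nat height_ge.
- exact: cvg_cst.
- exact: cvg_harmonic.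
Unshelve. all: by end_near. Qed.

Lemma odo_is_odometer : is_odometer unit_itv (@odo R).
Proof.
split; first exact: measurable_odo.
  by move=> x; rewrite !unit_itvE; exact: odo_itv.
exists adding_tower; split.
- exact: adding_tower_refines.
- under eq_fun do rewrite adding_tower_topE lebesgue_top.
  by apply: cvg_EFin; [exact: nearW|exact: cvg_heightV].
- by rewrite adding_tower_union.
(* At every point the tower maps are eventually constant, namely as soon as [n] exceeds
   [carry x]. *)
- apply: aeW => x X; apply: cvg_near_cst; near=> n.
  apply/eqP; rewrite adding_tower_map//; near: n; exact: nbhs_infty_gt.
Unshelve. all: by end_near. Qed.

End Odometer.

(** * Means of bounded functions *)

Section BoundedMeasurable.
Context d (T : measurableType d) (R : realType).
Implicit Types (D A : set T) (f g : T -> R).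

(** A class closed under the algebraic operations, so that integrability on sets of finite measure
    need not be reproved for each expression. *)
Definition bmeas D f :=
  measurable_fun D f /\ exists C : R, forall x, D x -> `|f x| <= C.

Lemma bmeas_cst D (r : R) : bmeas D (fun=> r).
Proof. by split; [exact: measurable_cst|exists `|r|]. Qed.

Lemma eq_bmeas D f g : (forall x, D x -> f x = g x) -> bmeas D f -> bmeas D g.
Proof.
move=> fg [mf [C fC]]; split.
  by apply: eq_measurable_fun mf => x /[!inE] /fg.
by exists C => x Dx; rewrite -fg// fC.
Qed.

Lemma bmeasD D f g : bmeas D f -> bmeas D g -> bmeas D (fun x => f x + g x).
Proof.
move=> [mf [C fC]] [mg [B gB]]; split; first exact: measurable_funD.
exists (C + B) => x Dx; rewrite (le_trans (ler_normD _ _))// lerD ?fC ?gB//.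
Qed.

Lemma bmeasM D f g : bmeas D f -> bmeas D g -> bmeas D (fun x => f x * g x).
Proof.
move=> [mf [C fC]] [mg [B gB]]; split; first exact: measurable_funM.
by exists (C * B) => x Dx; rewrite normrM ler_pM ?fC ?gB.
Qed.

Lemma bmeasZ D f (r : R) : bmeas D f -> bmeas D (fun x => r * f x).
Proof. by move=> bf; apply: bmeasM => //; exact: bmeas_cst. Qed.

Lemma bmeasB D f g : bmeas D f -> bmeas D g -> bmeas D (fun x => f x - g x).
Proof.
move=> bf bg; apply: eq_bmeas (bmeasD bf (bmeasZ (-1) bg)) => x _.
by rewrite mulN1r.
Qed.

Lemma bmeas_norm D f : bmeas D f -> bmeas D (fun x => `|f x|).
Proof.
move=> [mf [C fC]]; split; first exact: measurableT_comp.
by exists C => x Dx; rewrite normr_id fC.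
Qed.

Lemma bmeas_sum D I (s : seq I) (P : pred I) (f : I -> T -> R) :
  (forall i, bmeas D (f i)) -> bmeas D (fun x => \sum_(i <- s | P i) f i x).
Proof.
move=> bf; elim: s => [|i s IH].
  by apply: eq_bmeas (bmeas_cst D 0) => x _; rewrite big_nil.
have [Pi|Pi] := boolP (P i).
  by apply: eq_bmeas (bmeasD (bf i) IH) => x _; rewrite big_cons Pi.
by apply: eq_bmeas IH => x _; rewrite big_cons (negPf Pi).
Qed.

Lemma bmeas_bool D (b : T -> bool) :
  measurable_fun D b -> bmeas D (fun x => (b x)%:R).
Proof.
move=> mb; split.
  rewrite (_ : (fun x => _) = fun x => if b x then 1 else 0); last first.
    by apply/funext => x; case: (b x).
  by move=> mD; move: (mD); apply: measurable_fun_if => //; exact: measurable_cst.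
by exists 1 => x _; case: (b x); rewrite ?normr1 ?normr0.
Qed.

Variable mu : {measure set T -> \bar R}.

Lemma bmeas_integrable D f : measurable D -> (mu D < +oo)%E -> bmeas D f ->
  mu.-integrable D (EFin \o f).
Proof.
move=> mD Doo [mf [C fC]]; apply: measurable_bounded_integrable => //.
exists C; split; first exact: num_real.
by move=> M CM x Dx; rewrite /= (le_trans (fC x Dx))// ltW.
Qed.

End BoundedMeasurable.

(** * Change of variables between subsets *)

Section Transfer.
Context d1 d2 (T1 : measurableType d1) (T2 : measurableType d2) (R : realType).
Variables (m1 : {measure set T1 -> \bar R}) (m2 : {measure set T2 -> \bar R}).
Variables (D1 : set T1) (D2 : set T2) (phi : T1 -> T2).
Hypotheses (mD1 : measurable D1) (mD2 : measurable D2).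
Hypothesis mphi : measurable_fun setT phi.
Hypothesis m1oo : (m1 D1 < +oo)%E.
Hypothesis phiD : forall x, D1 x -> D2 (phi x).
Hypothesis m12 : forall A, measurable A -> m1 (D1 `&` phi @^-1` A) = m2 (D2 `&` A).

Lemma bmeas_comp (f : T2 -> R) : bmeas D2 f -> bmeas D1 (f \o phi).
Proof.
move=> [mf [C fC]]; split; last by exists C => x /phiD/fC.
by apply: (measurable_comp mD2) => //; [move=> _ [x /phiD ? <-]|exact: measurable_funTS].
Qed.

(** [f] is extended by 0 off [D2] and both measures are restricted to their domains; the formula for
    image measures on the whole space then applies. *)
Lemma Rintegral_transfer (f : T2 -> R) : bmeas D2 f ->
  \int[m1]_(x in D1) f (phi x) = \int[m2]_(x in D2) f x.
Proof.
move=> bf; pose f' := f \_ D2; pose r1 := mrestr m1 mD1.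
have r1oo : (r1 setT < +oo)%E by rewrite /r1 /mrestr setTI.
have mf' : measurable_fun setT f'.
  by apply/(measurable_restrictT _ mD2); case: bf.
have bf' : bmeas setT f'.
  case: bf => [_ [C fC]]; split=> //; exists `|C| => x _; rewrite /f' patchE.
  case: ifPn => [/[!inE]/fC/le_trans->//|_]; first exact: ler_norm.
  by rewrite normr0.
have if' : r1.-integrable setT (EFin \o f' \o phi).
  apply: (@bmeas_integrable _ _ _ _ _ (f' \o phi)) => //.
  split; first exact: measurableT_comp.
  by case: bf' => _ [C fC]; exists C => x _; exact: fC.
rewrite /Rintegral; congr fine.
transitivity (\int[r1]_(x in setT) (f' (phi x))%:E)%E.
  rewrite (@negligible_integral _ _ _ _ setT (~` D1))//; last 2 first.
  - exact: measurableC.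
  - by rewrite /r1/= /mrestr setICl measure0.
  rewrite setTD setCK.
  transitivity (\int[m1]_(x in D1) (f' (phi x))%:E)%E.
    by apply: eq_integral => x /[!inE] /phiD Dx; rewrite /f' patchE mem_set.
  by apply: eq_measure_integral => A mA AD; rewrite /r1/= /mrestr setIidl.
rewrite -[RHS](eq_integral _ (EFin \o f')); last first.
  by move=> x Dx; rewrite /f' /= patchE Dx.
have -> : (\int[r1]_x (f' (phi x))%:E =
           \int[pushforward r1 phi]_x (EFin \o f') x)%E.
  by rewrite integral_pushforward//; exact/measurable_EFinP.
transitivity (\int[mrestr m2 mD2]_x (EFin \o f') x)%E.
  apply: eq_measure_integral => A mA _.
  by rewrite /= /pushforward /= /mrestr setIC m12// setIC.
rewrite (@negligible_integral _ _ _ _ setT (~` D2))//; last 3 first.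
- exact: measurableC.
- apply: bmeas_integrable => //; rewrite /= /mrestr setTI -[D2]setIT -m12//.
  by rewrite preimage_setT setIT.
- by rewrite /= /mrestr setICl measure0.
rewrite setTD setCK.
by apply: eq_measure_integral => A mA AD; rewrite /= /mrestr setIidl.
Qed.

End Transfer.

(** * Means on the unit interval *)

Section Mean.
Context {R : realType}.
Implicit Types (f g : R -> R).

Local Notation mu := (@lebesgue_measure R).
Local Notation RR := (measurableTypeR R).
Local Notation X := (@unit_itv R : set RR).

Definition mean f : R := \int[mu]_(x in X) f x.

Lemma measurable_unit_itv : measurable X.
Proof. exact: measurable_itv. Qed.

Lemma mu_unit_itv : mu X = 1%E.
Proof. by rewrite lebesgue_measure_itv/= lte_fin ltr01 -EFinD subr0. Qed.

Lemma mu_unit_itv_lty : (mu X < +oo)%E.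
Proof. by rewrite mu_unit_itv ltry. Qed.

Local Hint Resolve measurable_unit_itv mu_unit_itv_lty : core.

Lemma bmeas_int f : bmeas X f -> mu.-integrable X (EFin \o f).
Proof. by move=> bf; apply: bmeas_integrable. Qed.

Lemma eq_mean f g : (forall x, X x -> f x = g x) -> mean f = mean g.
Proof. by move=> fg; apply: eq_Rintegral => x /[!inE] /fg. Qed.

Lemma mean_cst r : mean (fun=> r) = r.
Proof. by rewrite /mean Rintegral_cst//= mu_unit_itv mulr1. Qed.

Lemma meanD f g : bmeas X f -> bmeas X g ->
  mean (fun x => f x + g x) = mean f + mean g.
Proof. by move=> /bmeas_int if_ /bmeas_int ig; rewrite /mean RintegralD. Qed.

Lemma meanB f g : bmeas X f -> bmeas X g ->
  mean (fun x => f x - g x) = mean f - mean g.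
Proof. by move=> /bmeas_int if_ /bmeas_int ig; rewrite /mean RintegralB. Qed.

Lemma meanZ r f : bmeas X f -> mean (fun x => r * f x) = r * mean f.
Proof. by move=> /bmeas_int if_; rewrite /mean RintegralZl. Qed.

Lemma mean_sum I (s : seq I) (P : pred I) (f : I -> R -> R) :
  (forall i, bmeas X (f i)) ->
  mean (fun x => \sum_(i <- s | P i) f i x) = \sum_(i <- s | P i) mean (f i).
Proof.
move=> bf; elim: s => [|i s IH].
  by rewrite big_nil -[RHS](mean_cst 0); apply: eq_mean => x _; rewrite big_nil.
rewrite big_cons; case: ifPn => [Pi|Pi]; rewrite -IH.
  rewrite -meanD//; last exact: bmeas_sum.
  by apply: eq_mean => x _; rewrite big_cons Pi.
by apply: eq_mean => x _; rewrite big_cons (negPf Pi).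
Qed.

Lemma le_mean f g : bmeas X f -> bmeas X g -> (forall x, X x -> f x <= g x) ->
  mean f <= mean g.
Proof. by move=> /bmeas_int ? /bmeas_int ? fg; apply: le_Rintegral. Qed.

Lemma mean_ge0 f : (forall x, X x -> 0 <= f x) -> 0 <= mean f.
Proof. by move=> f0; apply: Rintegral_ge0. Qed.

Lemma mean_norm f : bmeas X f -> `|mean f| <= mean (fun x => `|f x|).
Proof. by move=> /bmeas_int ?; exact: le_normr_Rintegral. Qed.

Lemma mean_indic (A : set RR) : measurable A ->
  (mean (\1_A))%:E = mu (X `&` A).
Proof.
move=> mA; rewrite /mean /Rintegral integral_indic// setIC fineK//.
rewrite ge0_fin_numE// (le_lt_trans _ mu_unit_itv_lty)// le_measure ?inE//.
exact: measurableI.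
Qed.

Lemma mean_comp (phi : RR -> RR) f : measurable_fun X phi ->
    (forall x, X x -> X (phi x)) ->
    (forall A, measurable A -> mu (X `&` phi @^-1` A) = mu (X `&` A)) ->
    bmeas X f -> bmeas X (f \o phi) /\ mean (f \o phi) = mean f.
Proof.
move=> mphi phiX muphi bf.
(* [phi] is only measurable on [X]; cutting it off outside gives a map that is measurable on the
   whole line. *)
pose phi' := phi \_ X.
have pp x : X x -> phi' x = phi x by move=> Xx; rewrite /phi' patchE mem_set.
have mphi' : measurable_fun setT phi' by apply/(measurable_restrictT _ measurable_unit_itv).
have phiX' x : X x -> X (phi' x) by move=> Xx; rewrite pp//; exact: phiX.
split.
  have := bmeas_comp measurable_unit_itv mphi' phiX' bf.
  by apply: eq_bmeas => x Xx /=; rewrite pp.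
rewrite -[RHS](Rintegral_transfer (m1 := mu) measurable_unit_itv measurable_unit_itv mphi'
  mu_unit_itv_lty phiX' _ bf).
  by apply: eq_mean => x Xx /=; rewrite pp.
move=> A mA; apply: etrans (muphi A mA); congr (mu _); apply/seteqP.
by split=> x [Xx]; rewrite /preimage/= pp.
Qed.

End Mean.

(** * Invariance of Lebesgue measure under the adding machine *)

Section Invariance.
Context {R : realType}.
Implicit Types (x : R) (n i : nat).

Local Notation mu := (@lebesgue_measure R).
Local Notation RR := (measurableTypeR R).
Local Notation X := (@unit_itv R : set RR).

Lemma lebesgue_measure_shift (c : R) (A : set RR) : measurable A ->
  mu ((fun x : RR => x + c) @^-1` A) = mu A.
Proof.
move=> mA; rewrite -[LHS]/(pushforward mu (fun x : RR => x + c : RR) A).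
have ms : measurable_fun [set: RR] (fun x : RR => x + c : RR).
  by apply: measurable_funD => //; exact: measurable_cst.
apply/esym/lebesgue_measure_unique => // _ [[a b]] _ <-.
rewrite /= /pushforward.
rewrite (_ : _ @^-1` _ = `]a - c, b - c]%classic); last first.
  by apply/seteqP; split=> x; rewrite /= !in_itv/= ltrBlDr lerBrDr.
by rewrite !lebesgue_measure_itv/= !lte_fin ltrD2r -!EFinB opprB addrA addrNK.
Qed.

(** The image of [carry_set n] under the translation by which [odo] acts there. *)
Definition odo_carry_image n : set RR :=
  `[(height n.+1)%:R^-1, (height n)%:R^-1[%classic.

Lemma bigcup_odo_carry_image : \bigcup_n odo_carry_image n = `]0, 1[%classic.
Proof.
apply/seteqP; split=> x; rewrite /odo_carry_image /=.
  move=> [n _]; rewrite /= !in_itv/= => /andP[h1 h2].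
  rewrite (lt_le_trans _ h1) ?heightV_gt0//= (lt_le_trans h2)//.
  by rewrite invf_le1 ?heightR_gt0// ler1n height_gt0.
rewrite in_itv/= => /andP[x0 x1].
have ex : exists n, x^-1 <= (height n)%:R.
  exists (Num.truncn x^-1).+1; rewrite (le_trans (ltW (truncnS_gt _)))//.
  by rewrite ler_nat ltnW// height_ge.
(* The least [N] with 1 / x <= h_N is positive because x < 1, and [x] belongs to the piece of index
   N - 1. *)
pose N := ex_minn ex; have := erefl N; rewrite {2}/N.
case: ex_minnP => -[|n] hn minn _.
  by move: hn; rewrite invf_le1// leNgt x1.
exists n => //=; rewrite in_itv/=; apply/andP; split.
  by rewrite -[leRHS]invrK lef_pV2 ?posrE ?invr_gt0 ?heightR_gt0.
rewrite ltNge; apply/negP => h; have /minn : x^-1 <= (height n)%:R.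
  by rewrite -[leRHS]invrK lef_pV2 ?posrE ?heightV_gt0.
by rewrite ltnn.
Qed.

Lemma trivIset_odo_carry_image : trivIset setT odo_carry_image.
Proof.
have aux i j x : (i < j)%N -> odo_carry_image i x -> odo_carry_image j x -> False.
  move=> ij; rewrite /odo_carry_image/= !in_itv/= => /andP[h1 _] /andP[_ h2].
  have : (height j)%:R^-1 <= (height i.+1)%:R^-1 :> R.
    by rewrite lef_pV2 ?posrE ?heightR_gt0// ler_nat leq_height.
  by move=> h; have := lt_le_trans h2 (le_trans h h1); rewrite ltxx.
move=> i j _ _ [x [xi xj]].
by case: (ltngtP i j) => // ij; exfalso; [exact: aux xi xj|exact: aux xj xi].
Qed.

(** [odo] is an infinite interval exchange: the disjoint sets [carry_set n] are translated onto
    disjoint intervals filling ]0, 1[. Only the null set {0} is missed. *)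
Lemma lebesgue_measure_odo (A : set RR) : measurable A ->
  mu (X `&` (@odo R) @^-1` A) = mu (X `&` A).
Proof.
move=> mA.
pose tau n : R := - 1 + (height n)%:R^-1 + (height n.+1)%:R^-1.
have FE n : carry_set n `&` (@odo R) @^-1` A =
    (fun x : RR => x + tau n) @^-1` (odo_carry_image n `&` A).
  apply/seteqP; split=> x; rewrite /preimage /=.
    move=> [cx]; rewrite (odo_carry_set (mem_set cx)) => Ax; split=> //.
    move: cx; rewrite /carry_set /odo_carry_image /= !in_itv/= /tau.
    by move=> /andP[h1 h2]; apply/andP; split; lra.
  move=> [ix Ax].
  have cx : carry_set n x.
    move: ix; rewrite /carry_set /odo_carry_image /= !in_itv/= /tau.
    by move=> /andP[h1 h2]; apply/andP; split; lra.
  by split=> //; rewrite (odo_carry_set (mem_set cx)).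
have mE n : measurable (odo_carry_image n `&` A).
  by apply: measurableI => //; exact: measurable_itv.
have msh n : measurable ((fun x : RR => x + tau n) @^-1` (odo_carry_image n `&` A)).
  rewrite -[X in measurable X]setTI.
  have : measurable_fun [set: RR] (fun x : RR => x + tau n : RR).
    by apply: measurable_funD => //; exact: measurable_cst.
  by move=> /(_ measurableT _ (mE n)).
transitivity (mu (\bigcup_n (carry_set n `&` (@odo R) @^-1` A))).
  by rewrite -setI_bigcupl bigcup_carry_set.
rewrite measure_semi_bigcup; last 3 first.
- by move=> n; rewrite FE; exact: msh.
- move=> i j _ _ [x [[/carry_setP[_ <-] _] [/carry_setP[_ <-] _]]] //.
- by apply: bigcup_measurable => n _; rewrite FE; exact: msh.
transitivity (\sum_(n <oo) mu (odo_carry_image n `&` A))%E.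
  by apply: eq_eseriesr => n _; rewrite FE; exact: lebesgue_measure_shift.
rewrite -measure_semi_bigcup//; last 2 first.
- move=> i j _ _ [x [[xi _] [xj _]]].
  by apply: trivIset_odo_carry_image => //; exists x.
- by apply: bigcup_measurable => n _; exact: mE.
rewrite -setI_bigcupl bigcup_odo_carry_image.
rewrite (_ : X = [set 0] `|` `]0, 1[%classic); last first.
  by rewrite /unit_itv setU1itv// bnd_simp.
rewrite setUC setIUl measureU0//.
- by apply: measurableI => //; exact: measurable_itv.
- by apply: measurableI => //; exact: measurable_set1.
- apply/eqP; rewrite -measure_le0 -(lebesgue_measure_set1 0) le_measure ?inE//.
  by apply: measurableI => //; exact: measurable_set1.
Qed.

Lemma bmeas_odo (f : R -> R) : bmeas X f -> bmeas X (f \o @odo R).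
Proof.
move=> bf; apply: (mean_comp _ _ lebesgue_measure_odo bf).1.
  exact: measurable_odo.
by move=> x; rewrite !unit_itvE; exact: odo_itv.
Qed.

Lemma mean_odo (f : R -> R) : bmeas X f -> mean (f \o @odo R) = mean f.
Proof.
move=> bf; apply: (mean_comp _ _ lebesgue_measure_odo bf).2.
  exact: measurable_odo.
by move=> x; rewrite !unit_itvE; exact: odo_itv.
Qed.

Lemma bmeas_iter_odo i (f : R -> R) : bmeas X f ->
  bmeas X (fun x => f (iter i (@odo R) x)).
Proof.
elim: i f => // i IH f bf.
by apply: eq_bmeas (IH _ (bmeas_odo bf)) => x _ /=.
Qed.

Lemma mean_iter_odo i (f : R -> R) : bmeas X f ->
  mean (fun x => f (iter i (@odo R) x)) = mean f.
Proof.
elim: i f => // i IH f bf; rewrite -[RHS]mean_odo// -[RHS]IH//; exact: bmeas_odo.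
Qed.

End Invariance.

(** * Functions constant along blocks *)

Section Blocks.
Context {R : realType}.
Implicit Types (x : R) (n i t : nat) (phi : nat -> R) (psi : R -> R).

Local Notation mu := (@lebesgue_measure R).
Local Notation RR := (measurableTypeR R).
Local Notation X := (@unit_itv R : set RR).

Lemma measurable_truncn :
  measurable_fun [set: RR] (fun x => (Num.truncn x)%:R : R).
Proof.
by apply: nondecreasing_measurable => // x y xy; rewrite ler_nat le_truncn.
Qed.

Lemma measurable_tail n : measurable_fun [set: RR] (tail n : RR -> R).
Proof.
elim: n => [|n IH]; first exact: measurable_id.
apply: measurable_funB; first by apply: measurable_funM => //; exact: measurable_cst.
apply: (measurableT_comp measurable_truncn).
by apply: measurable_funM => //; exact: measurable_cst.
Qed.

Lemma measurable_digit n : measurable_fun [set: RR] (fun x => (digit n x)%:R : R).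
Proof.
apply: (measurableT_comp measurable_truncn).
by apply: measurable_funM; [exact: measurable_cst|exact: measurable_tail].
Qed.

Lemma measurable_position n :
  measurable_fun [set: RR] (fun x => (position n x)%:R : R).
Proof.
elim: n => [|n IH]; first exact: measurable_cst.
rewrite (_ : (fun x => _) =
    fun x => (position n x)%:R + (height n)%:R * (digit n x)%:R); last first.
  by apply/funext => x; rewrite /= natrD natrM.
apply: measurable_funD => //; apply: measurable_funM; first exact: measurable_cst.
exact: measurable_digit.
Qed.

Lemma bmeas_position n phi : bmeas X (fun x => phi (position n x)).
Proof.
have b : bmeas X (fun x => \sum_(t < height n) (phi t * (position n x == t)%:R)).
  apply: bmeas_sum => t; apply: bmeasZ; apply: bmeas_bool.
  rewrite (_ : (fun x => _) = fun x => (position n x)%:R == t%:R :> R); last first.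
    by apply/funext => x; rewrite eqr_nat.
  apply: measurable_funTS; apply: measurable_fun_eqr; first exact: measurable_position.
  exact: measurable_cst.
apply: eq_bmeas b => x; rewrite unit_itvE => x01.
rewrite (bigD1 (Ordinal (position_lt n x01)))//= eqxx mulr1 big1 ?addr0// => t tp.
rewrite (_ : (_ == _) = false) ?mulr0//; apply/negbTE.
by apply: contra tp => /eqP tp; apply/eqP/val_inj.
Qed.

Lemma bmeas_digit n phi : bmeas X (fun x => phi (digit n x)).
Proof.
apply: eq_bmeas (bmeas_position n.+1 (fun t => phi (t %/ height n)%N)) => x.
by rewrite unit_itvE => x01; rewrite position_div.
Qed.

(** Constancy along the orbit segments inside the tower of level [n]; the condition leaves out the
    top, where the orbit starts a new block. *)
Definition block_invariant n (S : Type) (psi : R -> S) : Prop :=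
  forall x, X x -> ((position n x).+1 < height n)%N -> psi (odo x) = psi x.

(** The blocks of a lower tower are pieces of the blocks of a higher one. *)
Lemma block_invariant_le m n (S : Type) (psi : R -> S) : (m <= n)%N ->
  block_invariant n psi -> block_invariant m psi.
Proof.
move=> mn inv x Xx; have Xx' := Xx; rewrite unit_itvE in Xx' => pm.
apply: inv => //; have := carry_lt Xx' pm => cm.
have [pn _] := odo_ntop Xx' (leq_trans cm mn).
by rewrite -pn position_lt// odo_itv.
Qed.

Lemma block_invariant_tail n : block_invariant n (tail n : R -> R).
Proof. by move=> x; rewrite unit_itvE => x01 /(carry_lt x01) /(odo_ntop x01)[]. Qed.

Lemma block_invariant_iter n (S : Type) (psi : R -> S) i x :
  block_invariant n psi -> X x -> (position n x + i < height n)%N ->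
  psi (iter i (@odo R) x) = psi x.
Proof.
move=> inv; rewrite unit_itvE => x01; elim: i => // i IH pi.
have pi' : (position n x + i < height n)%N by rewrite (leq_trans _ pi)// ltnS addnS.
rewrite iterS inv ?IH//; first by rewrite unit_itvE iter_odo_itv.
by rewrite position_iter// modn_small// -addnS.
Qed.

(** Independence of the position and of any block-invariant function: [odo] preserves the measure
    and moves each level to the next one, so [psi] has the same integral over all levels. *)
Lemma mean_block n phi psi : bmeas X psi -> block_invariant n psi ->
  mean (fun x => phi (position n x) * psi x) =
  (height n)%:R^-1 * (\sum_(t < height n) phi t) * mean psi.
Proof.
move=> bpsi inv; pose I t x : R := (position n x == t)%:R.
have bI t : bmeas X (I t).
  exact: (bmeas_position n (fun s => (s == t)%:R)).
have b t : bmeas X (fun x => I t x * psi x) by exact: bmeasM.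
have sumE (phi' : nat -> R) x : X x ->
    phi' (position n x) = \sum_(t < height n) phi' t * I t x.
  rewrite unit_itvE => x01.
  rewrite (bigD1 (Ordinal (position_lt n x01)))//= /I eqxx mulr1 big1 ?addr0// => t tp.
  rewrite (_ : (_ == _) = false) ?mulr0//; apply/negbTE.
  by apply: contra tp => /eqP tp; apply/eqP/val_inj.
have step t : (t.+1 < height n)%N ->
    mean (fun x => I t.+1 x * psi x) = mean (fun x => I t x * psi x).
  move=> tn; rewrite -mean_odo//; apply: eq_mean => x Xx /=.
  have x01 := Xx; rewrite unit_itvE in x01.
  (* On the top of the tower both indicators vanish: the next position is 0, and [t] is not the last
     level. *)
  rewrite /I position_odo//; have [pn|pn] := ltnP (position n x).+1 (height n).
    by rewrite modn_small// eqSS inv.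
  have -> : (position n x).+1 = height n by apply/eqP; rewrite eqn_leq pn position_lt.
  rewrite modnn /= mul0r (_ : (_ == _) = false) ?mul0r//.
  by apply/negbTE/eqP => pt; move: pn; rewrite pt leqNgt tn.
have const t : (t < height n)%N ->
    mean (fun x => I t x * psi x) = mean (fun x => I 0%N x * psi x).
  by elim: t => // t IH tn; rewrite step// IH// ltnW.
have mpsi : mean psi = (height n)%:R * mean (fun x => I 0%N x * psi x).
  have -> : mean psi = mean (fun x => \sum_(t < height n) I t x * psi x).
    apply: eq_mean => x Xx; rewrite -mulr_suml.
    have := sumE (fun=> 1) x Xx; under eq_bigr do rewrite mul1r.
    by move=> <-; rewrite mul1r.
  rewrite mean_sum//; under eq_bigr => t _ do rewrite const//.
  by rewrite sumr_const card_ord mulr_natl.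
transitivity (mean (fun x => \sum_(t < height n) phi t * (I t x * psi x))).
  apply: eq_mean => x Xx; rewrite sumE// mulr_suml.
  by apply: eq_bigr => t _; rewrite mulrA.
rewrite mean_sum; last by move=> t; exact: bmeasZ.
under eq_bigr => t _ do rewrite meanZ// const//.
by rewrite -mulr_suml mpsi; field; rewrite heightR_neq0.
Qed.

Lemma mean_position n phi :
  mean (fun x => phi (position n x)) = (height n)%:R^-1 * \sum_(t < height n) phi t.
Proof.
have := @mean_block n phi (fun=> 1) (bmeas_cst _ 1) (fun _ _ _ => erefl).
by rewrite mean_cst mulr1 => <-; apply: eq_mean => x _; rewrite mulr1.
Qed.

(** Open left rays are stable under intersection, generate the Borel sets and exhaust the line. *)
Lemma measure_unique_rays (m1 m2 : {measure set RR -> \bar R}) :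
  (m1 setT < +oo)%E -> (forall a : R, m1 `]-oo, a[%classic = m2 `]-oo, a[%classic) ->
  forall A, measurable A -> m1 A = m2 A.
Proof.
move=> m1oo m12 A; apply: (@measure_unique _ R RR (@RGenInftyO.G R) (fun k => `]-oo, k%:R[%classic)).
- exact: RGenInftyO.measurableE.
- move=> _ _ [a ->] [b ->]; exists (Num.min a b).
  by apply/seteqP; split=> x /=; rewrite !in_itv/= lt_min; [move=> [-> ->]|move=> /andP].
- by move=> k; eexists.
- rewrite -subTset => x _; exists (Num.truncn x).+1 => //=.
  by rewrite in_itv/= truncnS_gt.
- by move=> _ [a ->]; exact: m12.
- move=> k; apply: le_lt_trans m1oo; rewrite le_measure ?inE//.
Qed.

Lemma mu_lt_unit (a : R) : mu (X `&` `]-oo, a[%classic) =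
  (Num.min 1 (Num.max 0 a))%:E.
Proof.
rewrite (_ : _ `&` _ = `[0, Num.min 1 (Num.max 0 a)[%classic).
  rewrite lebesgue_measure_itv/= lte_fin; case: ifPn => [_|].
    by rewrite -EFinB subr0.
  rewrite -leNgt => h; apply/esym; congr EFin; apply/eqP; rewrite eq_le h.
  by rewrite le_min ler01 le_max lexx.
apply/seteqP; split=> x; rewrite /unit_itv /= !in_itv/= lt_min lt_max.
  by move=> [/andP[-> ->] ->]; rewrite orbT.
move=> /andP[x0 /andP[x1 /orP[x0'|->]]]; last by rewrite x0.
by move: x0; rewrite leNgt x0'.
Qed.

(** The tail is uniformly distributed. It suffices to treat rays; being block-invariant, the event
    that the tail is below [a] is independent of the position, so it may be measured on the lowest
    level alone, where the tail is h_n x. *)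
Lemma lebesgue_measure_tail n (A : set RR) : measurable A ->
  mu (X `&` (tail n : R -> R) @^-1` A) = mu (X `&` A).
Proof.
move=> mA.
have mtl : measurable_fun [set: RR] (tail n : RR -> RR) by exact: measurable_tail.
pose r := mrestr mu (@measurable_unit_itv R).
suff E : forall A, measurable A -> pushforward r (tail n : RR -> RR) A = r A.
  by have := E A mA; rewrite /pushforward /r /mrestr !(setIC X).
move=> {A mA}; apply: measure_unique_rays => [|a].
  by rewrite /= /pushforward /= /mrestr preimage_setT setTI mu_unit_itv ltry.
rewrite /= /pushforward /= /mrestr [in LHS]setIC [in RHS]setIC mu_lt_unit.
pose b x : bool := tail n x < a.
have bb : bmeas X (fun x => (b x)%:R : R).
  apply: bmeas_bool; apply: measurable_funTS; apply: measurable_fun_ltr => //.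
have inv : block_invariant n (fun x => (b x)%:R : R).
  by move=> x Xx px; rewrite /b (block_invariant_tail Xx px).
have mB : measurable ((tail n : RR -> RR) @^-1` `]-oo, a[%classic).
  by rewrite -[X in measurable X]setTI; apply: mtl => //; exact: measurable_itv.
have mb : (mean (fun x => (b x)%:R))%:E = mu (X `&` (tail n : R -> R) @^-1` `]-oo, a[%classic).
  rewrite -mean_indic//; congr EFin; apply: eq_mean => x _.
  rewrite indicE; congr (nat_of_bool _)%:R; apply/idP/idP.
    by move=> bx; apply/mem_set; rewrite /preimage /= in_itv.
  by move=> /set_mem; rewrite /preimage /= in_itv.
rewrite -mb; congr EFin.
have h0 := @heightR_gt0 R n.
have := mean_block (fun t => (t == 0%N)%:R) bb inv.
rewrite (bigD1 (Ordinal (height_gt0 n)))//= big1 ?addr0; last first.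
  move=> t t0; rewrite (_ : (_ == _) = false)//; apply/negbTE.
  by apply: contra t0 => /eqP t0; apply/eqP/val_inj.
rewrite mulr1 => H.
have -> : mean (fun x => (b x)%:R) =
    (height n)%:R * mean (fun x => (position n x == 0%N)%:R * (b x)%:R).
  by rewrite H mulrA mulfV ?heightR_neq0// mul1r.
set c := Num.min _ _.
have c0 : 0 <= c by rewrite le_min ler01 le_max lexx.
have c1 : c <= 1 by rewrite ge_min lexx.
suff -> : mean (fun x => (position n x == 0%N)%:R * (b x)%:R) = c / (height n)%:R.
  by rewrite mulrC divfK// heightR_neq0.
have hV1 : (height n)%:R^-1 <= 1 :> R by rewrite invf_le1// ler1n height_gt0.
have ch1 : c / (height n)%:R <= 1.
  by rewrite (le_trans _ hV1)// ger_pMl ?heightV_gt0.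
have ch0 : 0 <= c / (height n)%:R by rewrite divr_ge0// ltW.
apply: EFin_inj; transitivity (mu (X `&` `]-oo, c / (height n)%:R[%classic)); last first.
  by rewrite mu_lt_unit (max_idPr ch0) (min_idPr ch1).
rewrite -mean_indic; last exact: measurable_itv.
congr EFin; apply: eq_mean => x Xx; rewrite indicE -natrM mulnb.
have x01 := Xx; rewrite unit_itvE in x01; have /andP[u0 u1] := tail_itv n x01.
have xE := left_end_position n x01.
congr (nat_of_bool _)%:R; apply/idP/idP.
  move=> /andP[/eqP px bx]; apply/mem_set; rewrite /= in_itv/=.
  rewrite xE px left_end0 add0r ltr_pM2r ?heightV_gt0//.
  by rewrite lt_min u1 lt_max; move: bx; rewrite /b => ->; rewrite orbT.
move=> /set_mem; rewrite /= in_itv/= => xc.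
have xh : 0 <= x * (height n)%:R < 1.
  case/andP: x01 => x0 _; rewrite mulr_ge0 ?(ltW h0)//=.
  by rewrite -ltr_pdivlMr// mul1r (lt_le_trans xc)// ger_pMl ?heightV_gt0.
have [_] := coordinatesP (height_gt0 n) xh.
rewrite left_end0 add0r mulfK ?heightR_neq0// => -> tx.
rewrite /b tx eqxx /=.
have : x * (height n)%:R < c by rewrite -ltr_pdivlMr.
rewrite lt_min lt_max => /andP[_ /orP[|//]].
by case/andP: xh => xh0 _; rewrite ltNge xh0.
Qed.

Lemma mean_tail n psi : bmeas X psi -> mean (fun x => psi (tail n x)) = mean psi.
Proof.
move=> bf; apply: (mean_comp _ _ (@lebesgue_measure_tail n) bf).2.
  by apply: measurable_funTS; exact: measurable_tail.
by move=> x; rewrite !unit_itvE; exact: tail_itv.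
Qed.

End Blocks.

(** * The norming function *)

Section Growth.
Context {R : realType}.
Implicit Types (l n k : nat) (e t x : R).

(** The exponents balance three demands: 1 / [speed l] tends to 0, so that [growth] varies slowly;
    the product of the factors 1 + 1 / [speed l] diverges; and cap l / (l + 2) = 1 / (cap l * speed
    l) is negligible against 1 / [speed l]. *)
Definition speed l : R := Num.sqrt l.+2%:R.

Definition cap l : R := Num.sqrt (speed l).

(** The slowly varying sequence L; [increment] gives its summands c_j and [weight] the masses c_j
    h_j of the spikes. *)
Fixpoint growth n : R :=
  if n is n'.+1 then growth n' * (1 + (speed n')^-1) else 1.

Definition increment n : R :=
  if n is n'.+1 then growth n' / speed n' else 1.

Definition weight n : R := increment n * (height n)%:R.

Lemma speed_ge1 l : 1 <= speed l.
Proof. by rewrite /speed -[leLHS]sqrtr1 ler_sqrt// ler1n. Qed.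

Lemma speed_gt0 l : 0 < speed l.
Proof. by rewrite (lt_le_trans ltr01)// speed_ge1. Qed.

Lemma sqr_speed l : speed l ^+ 2 = l.+2%:R.
Proof. by rewrite sqr_sqrtr. Qed.

Lemma cap_ge1 l : 1 <= cap l.
Proof. by rewrite /cap -[leLHS]sqrtr1 ler_wsqrtr// speed_ge1. Qed.

Lemma cap_gt0 l : 0 < cap l.
Proof. by rewrite (lt_le_trans ltr01)// cap_ge1. Qed.

Lemma sqr_cap l : cap l ^+ 2 = speed l.
Proof. by rewrite sqr_sqrtr// ltW// speed_gt0. Qed.

Lemma growth_gt0 n : 0 < growth n.
Proof.
elim: n => [|n IH]; first exact: ltr01.
by rewrite mulr_gt0// addr_gt0// invr_gt0 speed_gt0.
Qed.

Lemma increment_ge0 n : 0 <= increment n.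
Proof. by case: n => //= n; rewrite divr_ge0// ltW// ?growth_gt0 ?speed_gt0. Qed.

Lemma weight_ge0 n : 0 <= weight n.
Proof. by rewrite mulr_ge0// increment_ge0. Qed.

Lemma growthS n : growth n.+1 = growth n + increment n.+1.
Proof. by rewrite /= mulrDr mulr1. Qed.

Lemma sum_increment n : \sum_(j < n.+1) increment j = growth n.
Proof.
elim: n => [|n IH]; first by rewrite big_ord_recl big_ord0 addr0.
by rewrite big_ord_recr IH growthS.
Qed.

Lemma le_growth m n : (m <= n)%N -> growth m <= growth n.
Proof.
elim: n => [|n IH]; first by rewrite leqn0 => /eqP->.
rewrite leq_eqVlt => /orP[/eqP->//|/IH h]; rewrite (le_trans h)//.
by rewrite growthS lerDl increment_ge0.
Qed.

Lemma growthS_le n : growth n.+1 <= 2 * growth n.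
Proof.
rewrite /= mulrC ler_wpM2r ?(ltW (growth_gt0 n))//.
by have := speed_ge1 n; rewrite -(invf_le1 (speed_gt0 n)); lra.
Qed.

Lemma speed_large e : exists N, forall n, (N <= n)%N -> e <= speed n.
Proof.
exists (Num.truncn (e ^+ 2)) => n Nn.
rewrite (le_trans (ler_norm _))// -sqrtr_sqr ler_sqrt//.
rewrite (le_trans (ltW (truncnS_gt _)))// ler_nat ltnS (leq_trans Nn)//.
Qed.

Lemma cap_large e : exists N, forall n, (N <= n)%N -> e <= cap n.
Proof.
have [N NP] := speed_large (e ^+ 2); exists N => n /NP en.
by rewrite (le_trans (ler_norm _))// -sqrtr_sqr ler_wsqrtr.
Qed.

Lemma speedV_small e : 0 < e -> exists N, forall n, (N <= n)%N -> (speed n)^-1 <= e.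
Proof.
move=> e0; have [N NP] := speed_large e^-1; exists N => n /NP en.
by rewrite -[leRHS]invrK lef_pV2 ?posrE ?speed_gt0 ?invr_gt0.
Qed.

Lemma growth_large e : exists N, forall n, (N <= n)%N -> e <= growth n.
Proof.
(* Induction with (1 + w)^2 >= 1 + 2 w for w = 1 / [speed n], where 2 (n + 1) w >= 1. *)
have sq n : n.+1%:R <= growth n ^+ 2.
  elim: n => [|n IH]; first by rewrite expr1n.
  have g0 := growth_gt0 n; have s0 := speed_gt0 n; have s2 := sqr_speed n.
  have s1 := speed_ge1 n.
  have sV : (speed n)^-1 * speed n = 1 by rewrite mulVf// gt_eqF.
  have sV0 : 0 < (speed n)^-1 by rewrite invr_gt0.
  have : n.+2%:R = n.+1%:R + 1 :> R by rewrite -natr1.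
  have n1 : 1 <= n.+1%:R :> R by rewrite ler1n.
  rewrite /= exprMn; move: (speed n) (growth n) (n.+2%:R) (n.+1%:R) s0 g0 s2 s1 sV sV0 IH n1.
  move=> s g p q s0 g0 s2 s1; move: s^-1 => v sV v0 IH q1 pq.
  have h : 1 <= 2 * q * v by rewrite -(ler_pM2r s0) -!mulrA sV mulr1; nra.
  have : q * (1 + 2 * v) <= g ^+ 2 * (1 + v) ^+ 2.
    by rewrite ler_pM//; [lra|nra|nra].
  by rewrite pq; nra.
exists (Num.truncn (e ^+ 2)) => n Nn.
rewrite (le_trans (ler_norm _))// -[leRHS](gtr0_norm (growth_gt0 n)).
rewrite -!sqrtr_sqr ler_wsqrtr// (le_trans _ (sq n))//.
by rewrite (le_trans (ltW (truncnS_gt _)))// ler_nat ltnS.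
Qed.

(* The mean of the renewed part of the spikes; it is [o (growth n)] because
   [cap l / l.+2] is negligible against the relative increment [(speed l)^-1]. *)
Definition defect n : R := \sum_(l < n) cap l / l.+2%:R * growth l.

Lemma defectS n : defect n.+1 = defect n + (cap n)^-1 * increment n.+1.
Proof.
rewrite /defect big_ord_recr/=; congr (_ + _).
by rewrite -sqr_speed -sqr_cap; field; rewrite gt_eqF// cap_gt0.
Qed.

(** Once [cap] exceeds 2 / e, every further increment of [defect] is at most e / 2 times that of
    [growth]; the initial part is absorbed because [growth] is unbounded. *)
Lemma defect_small e : 0 < e ->
  exists N, forall n, (N <= n)%N -> defect n <= e * growth n.
Proof.
move=> e0; have e20 : 0 < e / 2 by rewrite divr_gt0.
have [N1 N1P] := cap_large (e / 2)^-1.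
have H n : defect (N1 + n) <= defect N1 + e / 2 * (growth (N1 + n) - growth N1).
  elim: n => [|n IH]; first by rewrite addn0 subrr mulr0 addr0.
  rewrite addnS defectS growthS.
  have : (cap (N1 + n))^-1 <= e / 2.
    rewrite -[leRHS]invrK lef_pV2 ?posrE ?cap_gt0 ?invr_gt0//.
    by apply: N1P; rewrite leq_addr.
  move=> /(ler_wpM2r (increment_ge0 (N1 + n).+1)).
  lra.
have [N2 N2P] := growth_large ((e / 2)^-1 * defect N1).
exists (N1 + N2)%N => n nN; have := H (n - N1)%N.
rewrite subnKC ?(leq_trans _ nN) ?leq_addr// => h.
have : defect N1 <= e / 2 * growth n.
  rewrite -ler_pdivrMl// N2P// (leq_trans _ nN)// leq_addl//.
have : 0 <= e / 2 * growth N1 by rewrite mulr_ge0// ltW// growth_gt0.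
lra.
Qed.

(** The last weight carries the small factor 1 / [speed k]; all earlier heights are at most h_k =
    h_(k + 1) / (k + 2). This makes the boundary terms of a Birkhoff sum negligible. *)
Lemma sum_weight_le k :
  \sum_(j < k.+2) weight j <=
  (height k.+1)%:R * growth k.+1 * ((speed k)^-1 + k.+2%:R^-1).
Proof.
rewrite big_ord_recr.
have h1 : \sum_(j < k.+1) weight j <= (height k.+1)%:R * growth k.+1 * k.+2%:R^-1.
  rewrite (@le_trans _ _ (growth k * (height k)%:R))//.
    rewrite -sum_increment mulr_suml; apply: ler_sum => j _.
    by rewrite ler_wpM2l ?increment_ge0// ler_nat leq_height// -ltnS.
  have -> : (height k.+1)%:R * growth k.+1 / k.+2%:R = growth k.+1 * (height k)%:R.
    rewrite heightS natrM; have : k.+2%:R != 0 :> R by [].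
    by move: k.+2%:R => q q0; field.
  by rewrite ler_wpM2r// le_growth.
have h2 : weight k.+1 <= (height k.+1)%:R * growth k.+1 * (speed k)^-1.
  rewrite /weight mulrC -mulrA ler_wpM2l// ler_wpM2r ?invr_ge0 ?(ltW (speed_gt0 _))//.
  exact: (le_growth (leqnSn k)).
rewrite mulrDr addrC; exact: lerD.
Qed.

Definition norming t : R := t * growth (scale t).

Lemma norming_gt0 t : 0 < t -> 0 < norming t.
Proof. by move=> t0; rewrite mulr_gt0// growth_gt0. Qed.

Lemma norming_homo : {in `]0, +oo[ &, {homo norming : s t / s < t}}.
Proof.
move=> s t; rewrite !in_itv/= !andbT => s0 t0 st.
rewrite (@lt_le_trans _ _ (t * growth (scale s)))//.
  by rewrite ltr_pM2r// growth_gt0.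
by rewrite ler_pM2l// le_growth// le_scale// ltW.
Qed.

(** As soon as the radix at the scale of [t] exceeds [x], multiplying by [x] raises the scale by at
    most one, and [growth] by a factor at most 1 + 1 / [speed]. *)
Lemma growth_ratio x e : 1 <= x -> 0 < e -> exists T, forall t, T <= t ->
  growth (scale (x * t)) <= (1 + e) * growth (scale t).
Proof.
move=> x1 e0; have [N NP] := speedV_small e0.
exists (height (maxn N (Num.truncn x)))%:R => t Tt.
have t1 : 1 <= t by rewrite (le_trans _ Tt)// ler1n height_gt0.
have xt1 : 1 <= x * t by rewrite -[leLHS]mulr1 ler_pM.
have x0 : 0 < x by rewrite (lt_le_trans ltr01).
move: Tt; rewrite height_le_scale// geq_max => /andP[Ns xs].
have /andP[_ ts] := scale_itv t1.
have : (scale (x * t) <= (scale t).+1)%N.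
  rewrite leqNgt -height_le_scale// -ltNge heightS natrM.
  rewrite (@lt_le_trans _ _ (x * (height (scale t).+1)%:R))//.
    by rewrite ltr_pM2l.
  rewrite ler_wpM2r// (le_trans (ltW (truncnS_gt x)))// ler_nat ltnS.
  by rewrite (leq_trans xs)// ltnW.
move=> /le_growth/le_trans; apply; rewrite /= mulrC.
by rewrite ler_wpM2r ?(ltW (growth_gt0 _))// lerD2l NP.
Qed.

Lemma norming_regularly_varying : regularly_varying 1 norming.
Proof.
split=> [t|x x0]; first exact: norming_gt0.
rewrite powRr1 ?ltW//.
have key e : 0 < e -> e <= 1 -> exists2 T, 0 < T & forall t, T <= t ->
    `|growth (scale (x * t)) / growth (scale t) - 1| <= e.
  move=> e0 e1; have [x1|/ltW x1] := leP 1 x.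
    have [T TP] := growth_ratio x1 e0; exists (Num.max 1 T) => [|t].
      by rewrite lt_max ltr01.
    rewrite ge_max => /andP[t1 /TP h].
    have g0 := growth_gt0 (scale t).
    rewrite ger0_norm ?subr_ge0 ?ler_pdivlMr ?mul1r//.
      by rewrite lerBlDl ler_pdivrMr.
    by rewrite le_growth// le_scale// ler_peMl// (le_trans ler01).
  (* For x <= 1 the estimate is applied to 1 / x at the point x t; [e <= 1] serves to invert the
     factor 1 + e. *)
  have xV1 : 1 <= x^-1 by rewrite invr_ge1 ?unitfE ?gt_eqF.
  have [T TP] := growth_ratio xV1 e0; exists (Num.max 1 T / x) => [|t].
    by rewrite divr_gt0// lt_max ltr01.
  rewrite ler_pdivrMr// mulrC ge_max => /andP[t1 /TP].
  rewrite mulKf ?gt_eqF// => h.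
  have g0 := growth_gt0 (scale t); have g0' := growth_gt0 (scale (x * t)).
  rewrite distrC ger0_norm ?subr_ge0 ?ler_pdivrMr ?mul1r//.
    rewrite lerBlDl -lerBlDr ler_pdivlMr//; nra.
  by rewrite le_growth// le_scale// ger_pMl// -(pmulr_rgt0 _ x0) (lt_le_trans ltr01).
apply/cvgrPdist_le => e e0.
pose e' := Num.min 1 (e / x).
have e'0 : 0 < e' by rewrite lt_min ltr01 divr_gt0.
have e'1 : e' <= 1 by rewrite ge_min lexx.
have [T T0 TP] := key _ e'0 e'1.
near=> t.
have Tt : T <= t by near: t; exact: nbhs_pinfty_ge (num_real T).
have t0 : 0 < t by rewrite (lt_le_trans T0).
rewrite /norming.
have -> : x * t * growth (scale (x * t)) / (t * growth (scale t)) =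
    x * (growth (scale (x * t)) / growth (scale t)).
  by field; rewrite !gt_eqF// growth_gt0.
rewrite distrC -[X in `|_ - X|]mulr1 -mulrBr normrM (gtr0_norm x0).
rewrite mulrC -ler_pdivlMr//; apply: (le_trans (TP t Tt)).
by rewrite ge_min lexx orbT.
Unshelve. all: by end_near. Qed.

End Growth.

(** * Realizing the law on the unit interval *)

Section Quantile.
Context (R : realType) d (Omega : measurableType d) (P : probability Omega R).
Context (Y : {RV P >-> R}) (Ypos : forall w, 0 < Y w).

Local Notation mu := (@lebesgue_measure R).
Local Notation RR := (measurableTypeR R).
Local Notation X := (@unit_itv R : set RR).

(** Open rays make this function left continuous, so that [quantile u < a] and [u < lower_cdf a] are
    equivalent without exceptional points. *)
Let lower_cdf (a : R) : R := fine (P (Y @^-1` `]-oo, a[%classic)).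

Let measurable_lt (a : R) : measurable (Y @^-1` `]-oo, a[%classic).
Proof. exact: measurable_funPTI. Qed.

Let lower_cdfE a : (lower_cdf a)%:E = P (Y @^-1` `]-oo, a[%classic).
Proof. by rewrite /lower_cdf fineK// fin_num_measure. Qed.

Let lower_cdf_le a b : a <= b -> lower_cdf a <= lower_cdf b.
Proof.
move=> ab; rewrite -lee_fin !lower_cdfE le_measure ?inE//.
by move=> w /=; rewrite !in_itv/= => /lt_le_trans; apply.
Qed.

Let lower_cdf_left_continuous u a : u < lower_cdf a ->
  exists2 t, t < a & u < lower_cdf t.
Proof.
move=> ua.
pose F n := Y @^-1` `]-oo, (a - n.+1%:R^-1)[%classic.
have UF : \bigcup_n F n = Y @^-1` `]-oo, a[%classic.
  apply/seteqP; split=> w /=.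
    move=> [n _]; rewrite /F /= !in_itv/= => /lt_le_trans; apply.
    by rewrite gerBl.
  rewrite in_itv/= => Ya; exists (Num.truncn (a - Y w)^-1) => //.
  rewrite /F /= in_itv/= ltrBrDl -ltrBrDr.
  rewrite -[ltRHS]invrK ltf_pV2 ?posrE ?invr_gt0 ?subr_gt0//.
  exact: truncnS_gt.
have cvgF : P (F n) @[n --> \oo] --> P (Y @^-1` `]-oo, a[%classic).
  rewrite -UF; apply: nondecreasing_cvg_mu => //.
  - by move=> i; exact: measurable_lt.
  - by apply: bigcup_measurable => i _; exact: measurable_lt.
  move=> m n mn; apply/subsetPset => w; rewrite /F /= !in_itv/= => /lt_le_trans; apply.
  by rewrite lerD2l lerN2 lef_pV2 ?posrE// ler_nat.
rewrite -lower_cdfE in cvgF.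
have [n _ /(_ n (leqnn n)) /= un] := cvgr_gt (lower_cdf a) (fine_cvg cvgF) u ua.
by exists (a - n.+1%:R^-1); first by rewrite gtrBl.
Qed.

Let lower_cdf_cvg1 u : u < 1 -> exists t, u < lower_cdf t.
Proof.
move=> u1; pose F n := Y @^-1` `]-oo, (n%:R : R)[%classic.
have UF : \bigcup_n F n = setT.
  rewrite -subTset => w _; exists (Num.truncn (Y w)).+1 => //.
  by rewrite /F /= in_itv/= truncnS_gt.
have cvgF : P (F n) @[n --> \oo] --> P setT.
  rewrite -UF; apply: nondecreasing_cvg_mu => //.
  - by move=> i; exact: measurable_lt.
  - by apply: bigcup_measurable => i _; exact: measurable_lt.
  move=> m n mn; apply/subsetPset => w; rewrite /F /= !in_itv/= => /lt_le_trans; apply.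
  by rewrite ler_nat.
rewrite probability_setT in cvgF.
have [n _ /(_ n (leqnn n)) /= un] := cvgr_gt 1 (fine_cvg cvgF) u u1.
by exists n%:R.
Qed.

Let quantile (u : R) : R := inf [set t | u < lower_cdf t].

Let quantile_lt u a : 0 <= u < 1 -> (quantile u < a) = (u < lower_cdf a).
Proof.
move=> /andP[u0 u1].
have ne : [set t | u < lower_cdf t] !=set0 by have [t] := lower_cdf_cvg1 u1; exists t.
have lb : lbound [set t | u < lower_cdf t] 0.
  move=> t /= ut; rewrite leNgt; apply/negP => t0.
  move: ut; rewrite (_ : lower_cdf t = 0) ?ltNge ?u0//.
  apply: EFin_inj; rewrite lower_cdfE (_ : _ @^-1` _ = set0) ?measure0//.
  rewrite -subset0 => w /=; rewrite in_itv/= => /lt_trans/(_ t0).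
  by rewrite ltNge ltW.
apply/idP/idP => [qa|ua].
  have [t /= ut ta] := inf_lt ne qa.
  by rewrite (lt_le_trans ut)// lower_cdf_le// ltW.
have [t ta ut] := lower_cdf_left_continuous ua.
by apply: le_lt_trans ta; apply: ge_inf => //; exists 0.
Qed.

Lemma exists_same_law : exists v : R -> R,
  [/\ measurable_fun [set: RR] (v : RR -> RR), forall u, 0 < v u &
      forall A : set RR, measurable A -> mu (X `&` v @^-1` A) = P (Y @^-1` A)].
Proof.
pose q := quantile \_ X.
have qE u : X u -> q u = quantile u by move=> Xu; rewrite /q patchE mem_set.
have mq : measurable_fun [set: RR] (q : RR -> RR).
  apply/(measurable_restrictT _ (@measurable_unit_itv R)).
  have : measurable_fun X (quantile : RR -> R); last by [].
  apply: (measurability _ (RGenInftyO.measurableE R)) => //.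
  move=> _ [_ [a ->] <-].
  rewrite (_ : _ `&` _ = X `&` `]-oo, lower_cdf a[%classic); last first.
    apply/seteqP; split=> u [Xu]; rewrite /= !in_itv/=.
      by rewrite quantile_lt// -unit_itvE.
    by rewrite -quantile_lt// -unit_itvE.
  by apply: measurableI; [exact: measurable_unit_itv|exact: measurable_itv].
pose r := mrestr mu (@measurable_unit_itv R).
have mY : measurable_fun [set: Omega] (Y : Omega -> RR).
  by have : measurable_fun [set: Omega] Y by exact: measurable_funPT.
have lawq A : measurable A -> pushforward r (q : RR -> RR) A = pushforward P (Y : Omega -> RR) A.
  move: A; apply: measure_unique_rays => [|a].
    by rewrite /= /pushforward /= /mrestr preimage_setT setTI mu_unit_itv ltry.
  rewrite /= /pushforward /= /mrestr setIC.
  rewrite (_ : _ `&` _ = X `&` `]-oo, lower_cdf a[%classic); last first.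
    apply/seteqP; split=> u [Xu]; rewrite /= !in_itv/= qE//.
      by rewrite quantile_lt// -unit_itvE.
    by rewrite -quantile_lt// -unit_itvE.
  rewrite mu_lt_unit -lower_cdfE (max_idPr _) ?(min_idPr _)//.
    by rewrite -lee_fin lower_cdfE probability_le1.
  by rewrite -lee_fin lower_cdfE measure_ge0.
(* The quantile is made positive everywhere; as [Y] is positive, this does not change the law. *)
pose k (t : R) := if 0 < t then t else 1.
have mk : measurable_fun [set: RR] (k : RR -> RR).
  have : measurable_fun [set: RR] (k : RR -> R); last by [].
  apply: measurable_fun_if => //.
  by apply: measurable_fun_ltr => //; exact: measurable_cst.
exists (k \o q); split.
- exact: measurableT_comp.
- by move=> u; rewrite /k /=; case: ifPn.
- move=> A mA; have mkA : measurable ((k : RR -> RR) @^-1` A).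
    by rewrite -[X in measurable X]setTI; exact: mk.
  have := lawq _ mkA; rewrite /pushforward /r /= /mrestr setIC comp_preimage => ->.
  congr (P _); apply/seteqP; split=> w /=; rewrite /preimage /= /k Ypos//.
Qed.

End Quantile.

(** * Renewed states *)

Section States.
Context {R : realType} (v : R -> R).
Local Notation RR := (measurableTypeR R).
Local Notation X := (@unit_itv R : set RR).
Hypotheses (mv : measurable_fun [set: RR] (v : RR -> RR)) (vpos : forall u, 0 < v u).
Implicit Types (x : R) (l m n : nat) (phi : R -> R).

(** Reading the tail beyond digit [l] makes the value independent of that digit; as the tail is
    uniform, the law is that of [v] capped. *)
Definition fresh l x : R := Num.min (v (tail l.+1 x)) (cap l).

(* The junk value [1] only matters on the null set of points none of whose digits
   of index at least [l] vanishes. *)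
Fixpoint state_upto n l x : R :=
  if n is n'.+1 then
    if digit l x == 0%N then fresh l x else state_upto n' l.+1 x
  else 1.

(** The sequence is eventually constant, so the limit just picks its final value. *)
Definition state l x : R := lim (state_upto n l x @[n --> \oo]).

Let state_upto_stab k l x : digit (l + k) x = 0%N ->
  forall n, (k < n)%N -> state_upto n l x = state_upto k.+1 l x.
Proof.
elim: k l => [|k IH] l.
  by rewrite addn0 => d0 [//|n] _; rewrite /= d0 eqxx.
rewrite addnS -addSn => dk [//|n]; rewrite ltnS => kn /=.
by case: ifP => // _; rewrite IH.
Qed.

Lemma state_near l x : exists N, forall n, (N <= n)%N -> state_upto n l x = state l x.
Proof.
suff [c [N cN]] : exists c N, forall n, (N <= n)%N -> state_upto n l x = c.
  exists N; suff -> : state l x = c by [].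
  apply/cvg_lim => //; apply: cvg_near_cst; exists N => // n /=; exact: cN.
have [[k dk]|nod] := pselect (exists k, digit (l + k) x = 0%N).
  by exists (state_upto k.+1 l x), k.+1 => n; exact: state_upto_stab.
exists 1, 0%N => n _; elim: n l nod => //= n IH l nod.
case: ifPn => [/eqP d0|_]; first by case: nod; exists 0%N; rewrite addn0.
by apply: IH => -[k dk]; apply: nod; exists k.+1; rewrite addnS -addSn.
Qed.

Lemma state_rec l x :
  state l x = if digit l x == 0%N then fresh l x else state l.+1 x.
Proof.
have [N1 N1P] := state_near l x; have [N2 N2P] := state_near l.+1 x.
rewrite -(N1P (maxn N1 N2).+1) ?leqW ?leq_maxl//= -(N2P (maxn N1 N2))//.
exact: leq_maxr.
Qed.

Lemma fresh_gt0 l x : 0 < fresh l x.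
Proof. by rewrite lt_min vpos cap_gt0. Qed.

Lemma fresh_le l x : fresh l x <= cap l.
Proof. by rewrite ge_min lexx orbT. Qed.

Lemma state_gt0 l x : 0 < state l x.
Proof.
have [N /(_ N (leqnn N)) <-] := state_near l x; elim: N l => //= n IH l.
by case: ifP => // _; exact: fresh_gt0.
Qed.

Let measurable_fresh l : measurable_fun X (fresh l).
Proof.
apply: measurable_funTS; apply: measurable_minr; last exact: measurable_cst.
have mv' : measurable_fun [set: RR] (v : RR -> R) by [].
by apply: measurableT_comp mv' _; exact: measurable_tail.
Qed.

Lemma measurable_state l : measurable_fun X (state l).
Proof.
have msu n : measurable_fun X (state_upto n l).
  elim: n l => [|n IH] l; first exact: measurable_cst.
  have mX := @measurable_unit_itv R.
  apply: measurable_fun_if => //.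
  - rewrite (_ : (fun x => _) = fun x => (digit l x)%:R == 0 :> R).
      apply: measurable_funTS; apply: measurable_fun_eqr; first exact: measurable_digit.
      exact: measurable_cst.
    by apply/funext => x; rewrite pnatr_eq0.
  - by apply: measurable_funS (measurable_fresh l) => //; exact: subIsetl.
  - by apply: measurable_funS (IH l.+1) => //; exact: subIsetl.
apply: (measurable_fun_cvg msu) => x _; have [N NP] := state_near l x.
by apply: cvg_near_cst; exists N => // n /=; exact: NP.
Qed.

(** The state at level [l] only involves digits of index at least [l] and the tails behind them,
    which [odo] preserves below the top. *)
Lemma block_invariant_state l : block_invariant l (state l).
Proof.
move=> x Xx px; have x01 := Xx; rewrite unit_itvE in x01.
have cl := carry_lt x01 px.
have tl j : (l <= j)%N -> tail j (odo x) = tail j x.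
  by move=> lj; have [] := odo_ntop x01 (leq_trans cl lj).
have dl j : (l <= j)%N -> digit j (odo x) = digit j x.
  by move=> lj; rewrite /digit tl.
have su n j : (l <= j)%N -> state_upto n j (odo x) = state_upto n j x.
  elim: n j => // n IH j lj /=; rewrite dl//; case: ifP => _.
    by rewrite /fresh tl// leqW.
  by rewrite IH// leqW.
have [N1 N1P] := state_near l (odo x); have [N2 N2P] := state_near l x.
rewrite -(N1P (maxn N1 N2)) ?leq_maxl// -(N2P (maxn N1 N2)) ?leq_maxr//.
exact: su.
Qed.

Definition bmeasT phi :=
  measurable_fun [set: RR] (phi : RR -> R) /\ exists C : R, forall t, `|phi t| <= C.

Lemma bmeas_state phi l : bmeasT phi -> bmeas X (fun x => phi (state l x)).
Proof.
move=> [mphi [C phiC]]; split; last by exists C => x _; exact: phiC.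
exact: (measurableT_comp mphi (measurable_state l)).
Qed.

Let bmeas_fresh phi l : bmeasT phi -> bmeas X (fun x => phi (fresh l x)).
Proof.
move=> [mphi [C phiC]]; split; last by exists C => x _; exact: phiC.
exact: (measurableT_comp mphi (measurable_fresh l)).
Qed.

Let bmeas_min phi l : bmeasT phi -> bmeas X (fun x => phi (Num.min (v x) (cap l))).
Proof.
move=> [mphi [C phiC]]; split; last by exists C => x _; exact: phiC.
apply: (measurableT_comp mphi); apply: measurable_funTS.
apply: measurable_minr; last exact: measurable_cst.
by have : measurable_fun [set: RR] (v : RR -> R).
Qed.

Definition renewed l x : R := (digit l x == 0%N)%:R.

(** A vanishing digit [l] means lying in the first of the stacked blocks of length h_l; in this form
    [mean_block] applies. *)
Lemma renewedE l x : X x -> renewed l x = (position l.+1 x < height l)%N%:R.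
Proof.
rewrite unit_itvE => x01; rewrite /renewed; congr (nat_of_bool _)%:R.
have := position_lt l x01; rewrite /=; move: (position l x) (digit l x) => p e pl.
by apply/eqP/idP => [->|]; [rewrite muln0 addn0|case: e => //; nia].
Qed.

Lemma bmeas_renewed l : bmeas X (renewed l).
Proof. exact: (bmeas_digit l (fun e => (e == 0%N)%:R)). Qed.

Lemma renewed_itv l x : 0 <= renewed l x <= 1.
Proof. by rewrite /renewed; case: eqP => _; rewrite lexx ler01. Qed.

Lemma sum_ltn_ord a b : (b <= a)%N -> \sum_(t < a) (t < b)%N%:R = b%:R :> R.
Proof.
move=> ba; rewrite -natr_sum; congr _%:R.
rewrite -[RHS]card_ord -sum1_card (big_ord_widen _ (fun=> 1%N) ba) [RHS]big_mkcond.
by apply: eq_bigr => i _; case: ltnP.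
Qed.

Lemma height_ratio l : (height l.+1)%:R^-1 * (height l)%:R = l.+2%:R^-1 :> R.
Proof. by rewrite heightS natrM invfM mulfVK// heightR_neq0. Qed.

Lemma mean_renewed_block l (psi : R -> R) : bmeas X psi -> block_invariant l.+1 psi ->
  mean (fun x => renewed l x * psi x) = l.+2%:R^-1 * mean psi.
Proof.
move=> bpsi inv; have := mean_block (fun t => (t < height l)%N%:R) bpsi inv.
rewrite sum_ltn_ord ?leq_height// height_ratio => <-.
by apply: eq_mean => x Xx; rewrite renewedE.
Qed.

Lemma mean_renewed l : mean (renewed l) = l.+2%:R^-1.
Proof.
have := @mean_renewed_block l (fun=> 1) (bmeas_cst _ 1) (fun _ _ _ => erefl).
by rewrite mean_cst mulr1 => <-; apply: eq_mean => x _; rewrite mulr1.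
Qed.

(** Renewal has probability 1 / (l + 2) and is independent of both [fresh l] and [state l.+1], which
    are block-invariant at level l + 1. *)
Lemma mean_state phi l : bmeasT phi ->
  l.+2%:R * mean (fun x => phi (state l x)) =
  mean (fun x => phi (Num.min (v x) (cap l))) +
  l.+1%:R * mean (fun x => phi (state l.+1 x)).
Proof.
move=> bphi.
have bf := bmeas_fresh l bphi; have bs := bmeas_state l.+1 bphi.
have br := bmeas_renewed l.
have invf : block_invariant l.+1 (fun x => phi (fresh l x)).
  by move=> x Xx px; rewrite /fresh (block_invariant_tail Xx px).
have invs : block_invariant l.+1 (fun x => phi (state l.+1 x)).
  by move=> x Xx px; rewrite block_invariant_state.
have -> : mean (fun x => phi (state l x)) =
    mean (fun x => renewed l x * phi (fresh l x) +
      (phi (state l.+1 x) - renewed l x * phi (state l.+1 x))).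
  apply: eq_mean => x _; rewrite state_rec /renewed; case: ifP => _.
    by rewrite !mul1r subrr addr0.
  by rewrite !mul0r subr0 add0r.
rewrite meanD; [|exact: bmeasM|by apply: bmeasB => //; exact: bmeasM].
rewrite meanB//; last exact: bmeasM.
rewrite !mean_renewed_block// (mean_tail l.+1 (bmeas_min l bphi)).
have : l.+2%:R != 0 :> R by [].
rewrite (_ : l.+1%:R = l.+2%:R - 1); last by rewrite -(natr1 l.+1) addrK.
by move: l.+2%:R => q q0; field.
Qed.

(** Let D_i be the excess of the mean at level i over [alpha]. By [mean_state], D_i / (i + 1) is
    nondecreasing for i >= l, so a positive D_l would make D_i grow linearly, although [phi] is
    bounded. *)
Lemma mean_state_le phi l (alpha : R) : bmeasT phi ->
  (forall i, (l <= i)%N -> mean (fun x => phi (Num.min (v x) (cap i))) <= alpha) ->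
  mean (fun x => phi (state l x)) <= alpha.
Proof.
move=> bphi H; have [_ [C phiC]] := bphi.
pose D i : R := mean (fun x => phi (state i x)) - alpha.
have DS i : (l <= i)%N -> i.+2%:R * D i <= i.+1%:R * D i.+1.
  move=> /H Hi; rewrite /D !mulrBr mean_state//.
  rewrite -(natr1 i.+1) mulrDl mul1r; lra.
have Dn n : l.+1%:R^-1 * D l <= (l + n).+1%:R^-1 * D (l + n)%N.
  elim: n => [|n IH]; first by rewrite addn0.
  apply: (le_trans IH); rewrite addnS ler_pdivrMl// mulrA.
  have := DS (l + n)%N (leq_addr _ _).
  by rewrite mulrAC ler_pdivlMr// mulrC.
have DC i : D i <= C + `|alpha|.
  rewrite /D lerD//; last by rewrite -normrN ler_norm.
  rewrite -[leRHS]mean_cst; apply: le_mean; [exact: bmeas_state|exact: bmeas_cst|].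
  by move=> x _; rewrite (le_trans (ler_norm _)).
rewrite leNgt; apply/negP => al.
have Dl0 : 0 < D l by rewrite subr_gt0.
have C0 : 0 < C + `|alpha| by rewrite (lt_le_trans Dl0).
pose c := l.+1%:R^-1 * D l.
have c0 : 0 < c by rewrite mulr_gt0.
have := Dn (Num.truncn ((C + `|alpha|) / c)).
set n := Num.truncn _; apply/negP; rewrite -ltNge -/c.
rewrite mulrC ltr_pdivrMr// (le_lt_trans (DC _))// mulrC -ltr_pdivrMr//.
by rewrite (lt_le_trans (truncnS_gt _))// ler_nat ltnS leq_addl.
Qed.

Lemma le_cap m n : (m <= n)%N -> cap m <= cap n :> R.
Proof. by move=> mn; rewrite /cap ler_wsqrtr// /speed ler_wsqrtr// ler_nat !ltnS. Qed.

(** For i >= l, capping at [cap i] affects [v] only where it exceeds [cap l], and then changes [phi]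
    by at most 2 C. Apply [mean_state_le] to [phi] and to its opposite. *)
Lemma mean_state_cvg phi (C : R) l : measurable_fun [set: RR] (phi : RR -> R) ->
  (forall t, `|phi t| <= C) ->
  `|mean (fun x => phi (state l x)) - mean (fun x => phi (v x))| <=
  2 * C * mean (fun x => (cap l < v x)%R%:R).
Proof.
move=> mphi phiC.
have bphi : bmeasT phi by split=> //; exists C.
have mv' : measurable_fun [set: RR] (v : RR -> R) by [].
have bt i : bmeas X (fun x => (cap i < v x)%R%:R : R).
  by apply: bmeas_bool; apply: measurable_funTS; apply: measurable_fun_ltr => //.
have bv : bmeas X (fun x => phi (v x)).
  split; last by exists C => x _; exact: phiC.
  by apply: measurable_funTS; exact: measurableT_comp.
have C0 : 0 <= C by rewrite (le_trans (normr_ge0 _) (phiC 0)).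
have key (psi : R -> R) : (forall t, `|psi t| <= C) ->
    measurable_fun [set: RR] (psi : RR -> R) ->
    mean (fun x => psi (state l x)) <=
    mean (fun x => psi (v x)) + 2 * C * mean (fun x => (cap l < v x)%R%:R).
  move=> psiC mpsi; have bpsi : bmeasT psi by split=> //; exists C.
  have bpv : bmeas X (fun x => psi (v x)).
    split; last by exists C => x _; exact: psiC.
    by apply: measurable_funTS; exact: measurableT_comp.
  apply: mean_state_le => // i li.
  rewrite -meanZ// -meanD//; last exact: bmeasZ.
  apply: le_mean; [exact: bmeas_min|by apply: bmeasD => //; exact: bmeasZ|].
  move=> x _; have [vi|vi] := leP (v x) (cap i).
    by rewrite lerDl mulr_ge0// mulr_ge0.
  rewrite (le_lt_trans (le_cap li) vi) mulr1.
  have := psiC (cap i); have := psiC (v x).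
  rewrite !ler_norml => /andP[h1 h2] /andP[h3 h4]; lra.
rewrite ler_norml; apply/andP; split; last by rewrite lerBlDl; exact: key.
have N (g : R -> R) : bmeas X g -> mean (fun x => - g x) = - mean g.
  move=> bg; rewrite -[RHS]mulN1r -meanZ//.
  by apply: eq_mean => x _; rewrite mulN1r.
have : mean (fun x => - phi (state l x)) <= mean (fun x => - phi (v x)) +
    2 * C * mean (fun x => (cap l < v x)%R%:R).
  by apply: (key (fun t => - phi t)) => [t|]; [rewrite normrN|exact: measurable_funN].
rewrite !N//; last exact: bmeas_state.
lra.
Qed.

Lemma law_tight (e : R) : 0 < e -> exists a b : R, [/\ 0 < a, a <= b &
  mean (fun x => (~~ (a <= v x <= b))%:R) <= e].
Proof.
move=> e0.
have mv' : measurable_fun [set: RR] (v : RR -> R) by [].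
pose F n := X `&` (v : RR -> R) @^-1` `[n.+1%:R^-1, n.+1%:R]%classic.
have mF n : measurable (F n).
  by apply: (measurable_funTS mv'); [exact: measurable_unit_itv|exact: measurable_itv].
have UF : \bigcup_n F n = X.
  rewrite -setI_bigcupr -[RHS]setIT; congr (_ `&` _).
  rewrite -subTset => x _.
  exists (Num.truncn (Num.max (v x) (v x)^-1)) => //=; rewrite in_itv/=.
  set M := Num.max _ _; have Mn := truncnS_gt M.
  apply/andP; split; last by rewrite ltW// (le_lt_trans _ Mn)// le_max lexx.
  rewrite -[leRHS]invrK lef_pV2 ?posrE ?invr_gt0//.
  by rewrite ltW// (le_lt_trans _ Mn)// le_max lexx orbT.
have cvgF : lebesgue_measure (F n) @[n --> \oo] --> (1 : R)%:E.
  rewrite -(@mu_unit_itv R) -[X in _ --> lebesgue_measure X]UF.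
  apply: nondecreasing_cvg_mu => //.
    by apply: bigcup_measurable => n _.
  move=> m n mn; apply/subsetPset => x [Xx]; rewrite /F /= !in_itv/= => /andP[h1 h2].
  split=> //; rewrite (le_trans _ h1) ?(le_trans h2) ?ler_nat//.
  by rewrite lef_pV2 ?posrE// ler_nat.
have e1 : 1 - e < 1 by rewrite gtrBl.
have [n _ /(_ n (leqnn n)) /= Fn] := cvgr_gt 1 (fine_cvg cvgF) _ e1.
exists n.+1%:R^-1, n.+1%:R; split=> //.
  by rewrite (@le_trans _ _ 1) ?ler1n// invf_le1// ler1n.
have bI : bmeas X (fun x => (n.+1%:R^-1 <= v x <= n.+1%:R)%R%:R : R).
  apply: bmeas_bool; apply: measurable_funTS; apply: measurable_and;
    by apply: measurable_fun_ler => //; exact: measurable_cst.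
have -> : mean (fun x => (~~ (n.+1%:R^-1 <= v x <= n.+1%:R))%:R) =
    1 - mean (fun x => (n.+1%:R^-1 <= v x <= n.+1%:R)%R%:R).
  rewrite -[X in X - _]mean_cst -meanB//; last exact: bmeas_cst.
  by apply: eq_mean => x _; case: (_ <= _ <= _); rewrite /= ?subrr ?subr0.
suff <- : fine (lebesgue_measure (F n)) = mean (fun x => (n.+1%:R^-1 <= v x <= n.+1%:R)%R%:R).
  by lra.
have mI : measurable ((v : RR -> R) @^-1` `[n.+1%:R^-1, n.+1%:R]%classic).
  by rewrite -[X in measurable X]setTI; apply: mv' => //; exact: measurable_itv.
rewrite /F -mean_indic//=; apply: eq_mean => x _; rewrite indicE.
congr (nat_of_bool _)%:R; apply/idP/idP.
  by move=> /set_mem /=; rewrite in_itv.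
by move=> h; apply/mem_set; rewrite /= in_itv.
Qed.

End States.

(** * The spike function and its Birkhoff sums *)

Section CyclicSums.
Context {R : realType}.
Implicit Types (phi : nat -> R) (p n h i : nat).

Lemma cyclic_sumD phi p h m n :
  \sum_(i < m + n) phi ((p + i) %% h)%N =
  \sum_(i < m) phi ((p + i) %% h)%N + \sum_(i < n) phi ((p + m + i) %% h)%N.
Proof.
by rewrite big_split_ord/=; congr (_ + _); apply: eq_bigr => i _; rewrite addnA.
Qed.

Lemma cyclic_sum_period phi p h : (0 < h)%N ->
  \sum_(i < h) phi ((p + i) %% h)%N = \sum_(t < h) phi t.
Proof.
move=> h0; elim: p => [|p IH].
  by apply: eq_bigr => i _; rewrite add0n modn_small.
rewrite -IH; case: h h0 {IH} => // h _.
rewrite big_ord_recr [in RHS]big_ord_recl/= addrC; congr (_ + _).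
  by rewrite addn0 addSnnS modnDr.
by apply: eq_bigr => i _; rewrite addSnnS.
Qed.

(** There are n / h full periods and a partial one, whose sum lies between 0 and that of a full
    period. *)
Lemma cyclic_sum_bounds phi p h n : (0 < h)%N -> (forall t, 0 <= phi t) ->
  (n %/ h)%:R * \sum_(t < h) phi t <= \sum_(i < n) phi ((p + i) %% h)%N
  <= (n %/ h).+1%:R * \sum_(t < h) phi t.
Proof.
move=> h0 phi0; pose C := \sum_(t < h) phi t.
have full k q : \sum_(i < k * h) phi ((q + i) %% h)%N = k%:R * C.
  elim: k q => [|k IH] q; first by rewrite mul0n big_ord0 mul0r.
  by rewrite mulSn cyclic_sumD cyclic_sum_period// IH -(natr1 k) mulrDl mul1r addrC.
rewrite [in X in _ <= X <= _](divn_eq n h) cyclic_sumD full -/C.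
have r0 : 0 <= \sum_(i < n %% h) phi ((p + n %/ h * h + i) %% h)%N.
  by apply: sumr_ge0.
rewrite lerDl r0 -natr1 mulrDl mul1r lerD2l /=.
rewrite /C -(cyclic_sum_period phi (p + n %/ h * h) h0).
have rh : (n %% h <= h)%N by rewrite ltnW// ltn_mod.
rewrite (big_ord_widen _ (fun i => phi ((p + n %/ h * h + i) %% h)%N) rh).
rewrite [leLHS]big_mkcond; apply: ler_sum => i _; case: ifP => //.
Qed.

End CyclicSums.

(** * Spikes, renewals and the main term of Birkhoff sums *)

Section Spikes.
Context {R : realType} (v : R -> R).
Local Notation RR := (measurableTypeR R).
Local Notation X := (@unit_itv R : set RR).
Local Notation T := (@odo R).
Local Notation state := (state v).
Hypotheses (mv : measurable_fun [set: RR] (v : RR -> RR)) (vpos : forall u, 0 < v u).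
Implicit Types (x y : R) (j k l m n N K : nat).

(** The tops are nested: [x] lies on the top of the tower of level [j] exactly when [j <= carry x],
    so the sum over all levels is finite. *)
Definition spikes x : R := \sum_(j < (carry x).+1) weight j * state j x.

Definition is_top j x : R := (j <= carry x)%N%:R.

Lemma is_topE j x : X x -> is_top j x = (position j x == (height j).-1)%:R.
Proof. by rewrite unit_itvE => x01; rewrite position_topP// carryP. Qed.

Lemma is_top_ge0 j x : 0 <= is_top j x.
Proof. exact: ler0n. Qed.

Lemma bmeas_is_top j : bmeas X (is_top j).
Proof.
apply: eq_bmeas (bmeas_position j (fun t => (t == (height j).-1)%:R)) => x Xx.
by rewrite is_topE.
Qed.

Lemma sum_top h : (0 < h)%N -> \sum_(t < h) (t == h.-1 :> nat)%:R = 1 :> R.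
Proof.
move=> h0; have hl : (h.-1 < h)%N by rewrite prednK.
rewrite (bigD1 (Ordinal hl))//= eqxx big1 ?addr0// => t tl.
by rewrite (_ : (_ == _) = false)//; apply/negbTE.
Qed.

Lemma mean_is_top_block j (psi : R -> R) : bmeas X psi -> block_invariant j psi ->
  mean (fun x => is_top j x * psi x) = (height j)%:R^-1 * mean psi.
Proof.
move=> bpsi inv; have := mean_block (fun t => (t == (height j).-1)%:R) bpsi inv.
rewrite sum_top ?height_gt0// mulr1 => <-.
by apply: eq_mean => x Xx; rewrite is_topE.
Qed.

Lemma mean_is_top j : mean (is_top j) = (height j)%:R^-1.
Proof.
have := @mean_is_top_block j (fun=> 1) (bmeas_cst _ 1) (fun _ _ _ => erefl).
by rewrite mean_cst mulr1 => <-; apply: eq_mean => x _; rewrite mulr1.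
Qed.

Lemma spikes_upto K x : (carry x < K)%N ->
  spikes x = \sum_(j < K) weight j * (is_top j x * state j x).
Proof.
move=> cK; rewrite /spikes (big_ord_widen _ (fun j => weight j * state j x) cK).
rewrite big_mkcond/=; apply: eq_bigr => j _.
by rewrite /is_top ltnS; case: leqP => _; rewrite ?mul1r// mul0r mulr0.
Qed.

Lemma spikes_ge K x : \sum_(j < K) weight j * (is_top j x * state j x) <= spikes x.
Proof.
rewrite (spikes_upto (leq_maxr K (carry x).+1)).
rewrite (big_ord_widen _ (fun j => weight j * (is_top j x * state j x)) (leq_maxl K (carry x).+1)).
rewrite big_mkcond/=; apply: ler_sum => j _; case: ifP => // _.
by rewrite mulr_ge0 ?weight_ge0// mulr_ge0 ?is_top_ge0// ltW// state_gt0.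
Qed.

Lemma spikes_gt0 x : 0 < spikes x.
Proof.
rewrite /spikes big_ord_recl ltr_wpDr//.
  by apply: sumr_ge0 => j _; rewrite mulr_ge0 ?weight_ge0// ltW// state_gt0.
by rewrite mulr_gt0 ?state_gt0// /weight /= mul1r ltr0n.
Qed.

Lemma measurable_spikes : measurable_fun X (spikes : RR -> R).
Proof.
pose g K x := \sum_(j < K) weight j * (is_top j x * state j x).
have mg K : measurable_fun X (g K : RR -> R).
  elim: K => [|K IH].
    rewrite (_ : g 0%N = fun=> 0); first exact: measurable_cst.
    by apply/funext => x; rewrite /g big_ord0.
  rewrite (_ : g K.+1 = fun x => g K x + weight K * (is_top K x * state K x)); last first.
    by apply/funext => x; rewrite /g big_ord_recr.
  apply: measurable_funD => //; apply: measurable_funM; first exact: measurable_cst.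
  by apply: measurable_funM; [exact: (bmeas_is_top K).1|exact: measurable_state].
apply: (measurable_fun_cvg mg) => x _; apply: cvg_near_cst.
by exists (carry x).+1 => // K /= cK; rewrite [RHS](spikes_upto cK).
Qed.

(** Counts the renewals at the levels from [j] to K - 1, each weighted by the largest state it can
    produce. *)
Definition renewals j K x : R := \sum_(l < K) (j <= l)%N%:R * (cap l * renewed l x).

Lemma renewal_term_ge0 j l x : 0 <= (j <= l)%N%:R * (cap l * renewed l x) :> R.
Proof.
by rewrite !mulr_ge0// ?(ltW (cap_gt0 _))//; case/andP: (@renewed_itv R l x).
Qed.

Lemma renewals_ge0 j K x : 0 <= renewals j K x.
Proof. by apply: sumr_ge0 => l _; exact: renewal_term_ge0. Qed.

Lemma bmeas_renewals j K : bmeas X (renewals j K).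
Proof. by apply: bmeas_sum => l; do 2!apply: bmeasZ; exact: bmeas_renewed. Qed.

(** Descending from [K], the state changes only at a vanishing digit. After a renewal at level i it
    lies between 0 and [cap i], and [cap i >= 1] lets (1 + state K x) * cap i bound the distance. *)
Lemma state_dist j K x : (j <= K)%N ->
  `|state j x - state K x| <= (1 + state K x) * renewals j K x.
Proof.
have sK := state_gt0 vpos K x.
move=> jK; rewrite -(subKn jK); elim: (K - j)%N (leq_subr j K) => [|n IH] nK.
  by rewrite subn0 subrr normr0 mulr_ge0 ?renewals_ge0// addr_ge0// ltW.
have {}IH := IH (ltnW nK).
set i := (K - n.+1)%N in IH *; have iS : (K - n)%N = i.+1 by rewrite /i subnSK.
have iK : (i < K)%N by rewrite -iS leq_subr.
rewrite iS in IH; rewrite state_rec; case: ifPn => [d0|_]; last first.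
  apply: (le_trans IH); rewrite ler_wpM2l ?addr_ge0 ?(ltW sK)//.
  apply: ler_sum => l _; rewrite ler_wpM2r//.
    by rewrite mulr_ge0 ?(ltW (cap_gt0 _))//; case/andP: (@renewed_itv R l x).
  by rewrite ler_nat; case: (ltnP i l) => // /ltnW ->.
have capr : cap i <= renewals i K x.
  rewrite /renewals (bigD1 (Ordinal iK))//= leqnn mul1r /renewed d0 mulr1 lerDl.
  by apply: sumr_ge0 => l _; exact: renewal_term_ge0.
have := fresh_gt0 vpos i x; have := fresh_le v i x; have := cap_ge1 (R := R) i.
move: (fresh v i x) (cap i) (renewals i K x) capr => a c r cr c1 ac a0.
have : (1 + state K x) * c <= (1 + state K x) * r.
  by rewrite ler_wpM2l// addr_ge0// ltW.
by rewrite ler_norml => ?; apply/andP; split; nra.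
Qed.

(** Lying on the top of level [j] is independent of the digits of index at least [j]. *)
Lemma mean_renewals j K :
  mean (fun x => is_top j x * renewals j K x) =
  (height j)%:R^-1 * \sum_(l < K) (j <= l)%N%:R * (cap l / l.+2%:R).
Proof.
transitivity (mean (fun x => \sum_(l < K)
    ((j <= l)%N%:R * cap l) * (is_top j x * renewed l x))).
  by apply: eq_mean => x _; rewrite mulr_sumr; apply: eq_bigr => l _; ring.
have b l : bmeas X (fun x => is_top j x * renewed l x).
  by apply: bmeasM; [exact: bmeas_is_top|exact: bmeas_renewed].
rewrite mean_sum; last by move=> l; exact: bmeasZ.
rewrite mulr_sumr; apply: eq_bigr => l _; rewrite meanZ//.
have [jl|lj] := leqP j l; last by rewrite !mul0r mulr0.
rewrite mean_is_top_block ?mean_renewed; [by rewrite !mul1r; ring|exact: bmeas_renewed|].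
apply: (block_invariant_le jl) => x Xx px.
by rewrite /renewed /digit (block_invariant_tail Xx px).
Qed.

(** The sum bounds the cost of replacing all states by that of level k + 2; the last term is the
    spike of level k + 1, too rare to average out within fewer than h_(k + 1) steps. *)
Definition deviation k x : R :=
  \sum_(j < k.+2) weight j * (is_top j x * renewals j k.+2 x) +
  weight k.+1 * is_top k.+1 x.

Lemma deviation_ge0 k x : 0 <= deviation k x.
Proof.
apply: addr_ge0; last by apply: mulr_ge0; [exact: weight_ge0|exact: is_top_ge0].
apply: sumr_ge0 => j _; apply: mulr_ge0; first exact: weight_ge0.
by apply: mulr_ge0; [exact: is_top_ge0|exact: renewals_ge0].
Qed.

Lemma bmeas_top_renewals j K : bmeas X (fun x => weight j * (is_top j x * renewals j K x)).
Proof.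
by apply/bmeasZ/bmeasM; [exact: bmeas_is_top|exact: bmeas_renewals].
Qed.

Lemma bmeas_deviation k : bmeas X (deviation k).
Proof.
apply: bmeasD; last exact/bmeasZ/bmeas_is_top.
by apply: bmeas_sum => j; exact: bmeas_top_renewals.
Qed.

Lemma weightV j : weight j / (height j)%:R = increment j :> R.
Proof. by rewrite /weight mulfK// heightR_neq0. Qed.

(** Exchanging the sums, the increments of index at most l add up to [growth l], which is how
    [defect] arises. *)
Lemma mean_top_renewals m n : (n <= m)%N ->
  mean (fun x => \sum_(j < m) weight j * (is_top j x * renewals j n x)) = defect n.
Proof.
move=> nm; rewrite mean_sum; last by move=> j; exact: bmeas_top_renewals.
transitivity (\sum_(j < m) \sum_(l < n)
    (cap l / l.+2%:R) * ((j <= l)%N%:R * increment j : R)).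
  apply: eq_bigr => j _; rewrite meanZ; last first.
    by apply: bmeasM; [exact: bmeas_is_top|exact: bmeas_renewals].
  rewrite mean_renewals.
  by rewrite mulrA weightV mulr_sumr; apply: eq_bigr => l _; ring.
rewrite exchange_big/= /defect; apply: eq_bigr => l _.
rewrite -mulr_sumr -sum_increment; congr (_ * _).
rewrite (big_ord_widen m increment) ?(leq_trans _ nm)// [RHS]big_mkcond/=.
by apply: eq_bigr => j _; rewrite ltnS; case: leqP => _; rewrite ?mul1r ?mul0r.
Qed.

Lemma mean_deviation k : mean (deviation k) = defect k.+2 + increment k.+1.
Proof.
rewrite meanD; last 2 first.
- by apply: bmeas_sum => j; exact: bmeas_top_renewals.
- exact/bmeasZ/bmeas_is_top.
rewrite meanZ; last exact: bmeas_is_top.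
by rewrite mean_is_top weightV mean_top_renewals.
Qed.

(** The orbit meets the top of level [j] exactly once in every h_j steps, so the number of visits is
    N / h_j up to one. *)
Lemma visits j N x : X x ->
  `|weight j * \sum_(i < N) is_top j (iter i T x) - N%:R * increment j| <= weight j.
Proof.
move=> Xx; have x01 := Xx; rewrite unit_itvE in x01.
have hj := @heightR_gt0 R j.
have E : \sum_(i < N) is_top j (iter i T x) =
    \sum_(i < N) (((position j x + i) %% height j)%N == (height j).-1)%:R.
  apply: eq_bigr => i _; rewrite is_topE ?position_iter//.
  by rewrite unit_itvE iter_odo_itv.
have := @cyclic_sum_bounds R (fun t => (t == (height j).-1)%:R) (position j x)
  (height j) N (height_gt0 j) (fun t => ler0n _ _).
rewrite sum_top ?height_gt0// !mulr1 -E => /andP[h1 h2].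
have q1 : (N %/ height j)%:R * (height j)%:R <= N%:R :> R.
  by rewrite -natrM ler_nat leq_divM.
have q2 : N%:R <= (N %/ height j).+1%:R * (height j)%:R :> R.
  by rewrite -natrM ler_nat ltnW// ltn_ceil// height_gt0.
rewrite -natr1 in h2 q2.
have i0 := @increment_ge0 R j.
rewrite /weight; move: (increment j) (height j)%:R (N %/ height j)%:R (N%:R) (\sum_(_ < _) _) i0 hj h1 h2 q1 q2.
move=> c h q n s c0 h0 qs sq qn nq.
have -> : c * h * s - n * c = c * (h * s - n) by ring.
rewrite normrM (ger0_norm c0) ler_wpM2l// ler_norml; apply/andP; split; nra.
Qed.

(** As the orbit avoids the top of level k + 2, the state of that level is constant along it.
    Replacing all lower states by it costs the renewals, and counting visits level by level gives
    the main term. *)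
Lemma birkhoff_spikes k N x : X x -> (forall i, (i < N)%N -> (carry (iter i T x) < k.+2)%N) ->
  `|birkhoff_sum T spikes N x - state k.+2 x * (N%:R * growth k)| <=
  (1 + state k.+2 x) *
    (\sum_(i < N) deviation k (iter i T x) + \sum_(j < k.+1) weight j).
Proof.
move=> Xx good; set K := k.+2.
have x01 := Xx; rewrite unit_itvE in x01.
have s0 := state_gt0 vpos K x.
have stateK i : (i < N)%N -> state K (iter i T x) = state K x.
  elim: i => // i IH iN; rewrite iterS block_invariant_state ?IH ?(ltnW iN)//.
    by rewrite unit_itvE iter_odo_itv.
  have Ti := iter_odo_itv i x01; have [ci _] := odo_ntop Ti (good i (ltnW iN)).
  by rewrite -ci position_lt// odo_itv.
pose main := \sum_(i < N) \sum_(j < K) weight j * (is_top j (iter i T x) * state K x).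
have h1 : `|birkhoff_sum T spikes N x - main| <= (1 + state K x) *
    \sum_(i < N) \sum_(j < K) weight j * (is_top j (iter i T x) * renewals j K (iter i T x)).
  rewrite /birkhoff_sum /main -sumrB mulr_sumr; apply: (le_trans (ler_norm_sum _ _ _)).
  apply: ler_sum => i _; rewrite (spikes_upto (good i (ltn_ord i))) -sumrB mulr_sumr.
  apply: (le_trans (ler_norm_sum _ _ _)); apply: ler_sum => j _.
  rewrite -mulrBr -mulrBr normrM (ger0_norm (weight_ge0 _)) normrM (ger0_norm (is_top_ge0 _ _)).
  rewrite [leRHS]mulrCA ler_wpM2l ?weight_ge0// [leRHS]mulrCA ler_wpM2l ?is_top_ge0//.
  by rewrite -(stateK i (ltn_ord i)) state_dist// ltnW.
pose V j := weight j * \sum_(i < N) is_top j (iter i T x).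
have mainE : main = state K x * \sum_(j < K) V j.
  rewrite /main exchange_big mulr_sumr/=; apply: eq_bigr => j _.
  by rewrite /V !mulr_sumr; apply: eq_bigr => i _; ring.
have V0 j : 0 <= V j.
  by rewrite mulr_ge0 ?weight_ge0//; apply: sumr_ge0 => i _; exact: is_top_ge0.
(* The levels up to k yield the increments summing to [growth k]; level k + 1 is counted entirely as
   an error. *)
have h2 : `|\sum_(j < K) V j - N%:R * growth k| <=
    weight k.+1 * \sum_(i < N) is_top k.+1 (iter i T x) + \sum_(j < k.+1) weight j.
  rewrite /K big_ord_recr -sum_increment mulr_sumr addrAC -sumrB.
  rewrite addrC (le_trans (ler_normD _ _))// lerD//; first by rewrite ger0_norm.
  by apply: (le_trans (ler_norm_sum _ _ _)); apply: ler_sum => j _; exact: visits.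
have -> : birkhoff_sum T spikes N x - state K x * (N%:R * growth k) =
    (birkhoff_sum T spikes N x - main) +
    state K x * (\sum_(j < K) V j - N%:R * growth k).
  by rewrite mainE; ring.
rewrite (le_trans (ler_normD _ _))// normrM (gtr0_norm s0).
have -> : \sum_(i < N) deviation k (iter i T x) =
  \sum_(i < N) \sum_(j < K) weight j * (is_top j (iter i T x) * renewals j K (iter i T x)) +
  weight k.+1 * \sum_(i < N) is_top k.+1 (iter i T x).
  by rewrite mulr_sumr -big_split.
rewrite -addrA mulrDr lerD//.
apply: (@le_trans _ _ ((1 + state K x) * `|\sum_(j < K) V j - N%:R * growth k|)).
  by rewrite ler_wpM2r// lerDr.
by rewrite ler_wpM2l// addr_ge0// ltW.
Qed.

End Spikes.

(** * Closeness in measure to the reference state *)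

Section Bounds.
Context {R : realType} (v : R -> R).
Local Notation RR := (measurableTypeR R).
Local Notation X := (@unit_itv R : set RR).
Local Notation T := (@odo R).
Local Notation state := (state v).
Local Notation spikes := (spikes v).
Hypotheses (mv : measurable_fun [set: RR] (v : RR -> RR)) (vpos : forall u, 0 < v u).
Implicit Types (x y e : R) (j k l m n N K : nat).

Lemma measurable_iter_odo i (f : RR -> R) : measurable_fun X f ->
  measurable_fun X (fun x => f (iter i T x)).
Proof.
have mX := @measurable_unit_itv R.
elim: i f => // i IH f mf; have mfo : measurable_fun X (f \o T).
  apply: (measurable_comp mX) => //; last exact: measurable_odo.
  by move=> _ [x Xx <-]; rewrite unit_itvE; apply: odo_itv; rewrite -unit_itvE.
by have := IH _ mfo; apply: eq_measurable_fun => x _.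
Qed.

Lemma measurable_birkhoff N : measurable_fun X (birkhoff_sum T spikes N : RR -> R).
Proof.
elim: N => [|N IH].
  rewrite (_ : birkhoff_sum _ _ _ = fun=> 0); first exact: measurable_cst.
  by apply/funext => x; rewrite /birkhoff_sum big_ord0.
rewrite (_ : birkhoff_sum _ _ _ =
    fun x => birkhoff_sum T spikes N x + spikes (iter N T x)); last first.
  by apply/funext => x; rewrite /birkhoff_sum big_ord_recr.
by apply: measurable_funD => //; apply: measurable_iter_odo; exact: measurable_spikes.
Qed.

(** For h_k <= N < h_(k + 1) this is k + 2: an orbit segment of length N meets the top of that tower
    with probability at most N / h_(k + 2) < 1 / (k + 3). *)
Definition reference N : nat := (scale (N%:R : R)).+2.

Definition normalized N x : R := (norming N%:R)^-1 * birkhoff_sum T spikes N x.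

Lemma measurable_normalized N : measurable_fun X (normalized N : RR -> R).
Proof. by apply: measurable_funM; [exact: measurable_cst|exact: measurable_birkhoff]. Qed.

(** The tolerance is relative to 1 + state, the factor in the error bound of [birkhoff_spikes]. *)
Definition far (delta : R) N x : bool :=
  delta * (1 + state (reference N) x) < `|normalized N x - state (reference N) x|.

Lemma bmeas_far delta N : bmeas X (fun x => (far delta N x)%:R : R).
Proof.
have ms := measurable_state mv (reference N).
apply: bmeas_bool; apply: measurable_fun_ltr.
  apply: measurable_funM; first exact: measurable_cst.
  by apply: measurable_funD => //; exact: measurable_cst.
apply: measurableT_comp => //; apply: measurable_funB => //.
exact: measurable_normalized.
Qed.

Lemma le_bool1 (b : bool) (r : R) : 0 <= r -> (b -> 1 <= r) -> b%:R <= r.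
Proof. by case: b => // _; apply. Qed.

(** A pointwise Markov inequality: either the orbit meets the top of level k + 2 and the first sum
    is at least 1, or [birkhoff_spikes] applies and forces the second term to be at least 1. *)
Lemma far_le delta N x : 0 < delta -> (0 < N)%N -> X x ->
  let k := scale (N%:R : R) in
  (far delta N x)%:R <= \sum_(i < N) is_top k.+2 (iter i T x) +
    (delta * N%:R * growth k)^-1 *
    (\sum_(i < N) deviation k (iter i T x) + \sum_(j < k.+1) weight j).
Proof.
move=> delta0 N0 Xx /=; set k := scale _; set S1 := \sum_(i < N) is_top _ _; set S2 := \sum_(i < N) deviation _ _ + _.
have N0' : 0 < N%:R :> R by rewrite ltr0n.
have g0 := @growth_gt0 R k; have s0 := state_gt0 vpos k.+2 x.
have S10 : 0 <= S1 by apply: sumr_ge0 => i _; exact: is_top_ge0.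
have S20 : 0 <= S2.
  apply: addr_ge0; apply: sumr_ge0 => i _; last exact: weight_ge0.
  exact: deviation_ge0.
have d0 : 0 < delta * N%:R * growth k by rewrite !mulr_gt0.
have S30 : 0 <= (delta * N%:R * growth k)^-1 * S2 by rewrite mulr_ge0// invr_ge0 ltW.
apply: le_bool1 => [|fx]; first exact: addr_ge0.
have [[i [iN ci]]|good] := pselect (exists i, (i < N)%N /\ (k.+2 <= carry (iter i T x))%N).
  rewrite (@le_trans _ _ S1)// ?lerDl// /S1 (bigD1 (Ordinal iN))//=.
  by rewrite {1}/is_top ci lerDl; apply: sumr_ge0 => l _; exact: is_top_ge0.
have {}good i : (i < N)%N -> (carry (iter i T x) < k.+2)%N.
  by move=> iN; rewrite ltnNge; apply/negP => ci; apply: good; exists i.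
have := birkhoff_spikes vpos Xx good; rewrite -/S2 => h.
rewrite (@le_trans _ _ ((delta * N%:R * growth k)^-1 * S2)) ?lerDr//.
rewrite ler_pdivlMl// mulr1.
have Ng : 0 < N%:R * growth k :> R by rewrite mulr_gt0.
move: fx; rewrite /far /normalized /reference -/k /norming -/k => fx.
have : delta * (1 + state k.+2 x) * (N%:R * growth k) <= (1 + state k.+2 x) * S2.
  apply: le_trans h; rewrite -ler_pdivlMr// ltW// (lt_le_trans fx)//.
  rewrite -[X in _ <= X / _]/(`|_ - _|).
  rewrite -[X in _ <= _ / X](gtr0_norm Ng) -normrV ?unitfE ?gt_eqF// -normrM.
  by rewrite mulrBl mulfK ?gt_eqF// mulrC.
have s1 : 0 < 1 + state k.+2 x by rewrite addr_gt0.
by rewrite mulrAC mulrC ler_pM2l// mulrA.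
Qed.

Lemma normalized_far_small delta e : 0 < delta -> 0 < e ->
  exists N0, forall N, (N0 <= N)%N -> mean (fun x => (far delta N x)%:R) <= e.
Proof.
move=> delta0 e0.
(* [e1] bounds the top visits by e / 4 and makes 3 e1 <= delta e / 4, for one increment and the
   boundary weights; 4 [e2] = delta e / 4 is for the defect, where 4 bounds growth (k + 2) / growth
   k. *)
pose e1 := Num.min (e / 4) (e * delta / 12).
have e10 : 0 < e1 by rewrite lt_min !divr_gt0// mulr_gt0.
have e1e : e1 <= e / 4 by rewrite ge_min lexx.
have e1d : e1 <= e * delta / 12 by rewrite ge_min lexx orbT.
pose e2 := delta * e / 16.
have e20 : 0 < e2 by rewrite divr_gt0// mulr_gt0.
have [n1 n1P] := speedV_small e10; have [n2 n2P] := @defect_small R _ e20.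
exists (height (n1 + n2).+1) => N hN.
have N0 : (0 < N)%N by rewrite (leq_trans _ hN)// height_gt0.
have N1 : 1 <= N%:R :> R by rewrite ler1n.
have N0' : 0 < N%:R :> R by rewrite ltr0n.
pose k := scale (N%:R : R).
have kn : (n1 + n2 < k)%N by rewrite -height_le_scale// ler_nat.
have /andP[hk1 hk2] := scale_itv N1.
have [k' kE] : exists k', k = k'.+1 by case: (k) kn => // k' _; exists k'.
have bi : bmeas X (fun x => \sum_(i < N) is_top k.+2 (iter i T x)).
  by apply: bmeas_sum => i; apply: bmeas_iter_odo; exact: bmeas_is_top.
have bd : bmeas X (fun x => \sum_(i < N) deviation k (iter i T x)).
  by apply: bmeas_sum => i; apply: bmeas_iter_odo; exact: bmeas_deviation.
have bw : bmeas X (fun x => \sum_(j < k.+1) weight j : R) by exact: bmeas_cst.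
apply: (@le_trans _ _ (mean (fun x => \sum_(i < N) is_top k.+2 (iter i T x) +
    (delta * N%:R * growth k)^-1 *
    (\sum_(i < N) deviation k (iter i T x) + \sum_(j < k.+1) weight j)))).
  apply: le_mean; [exact: bmeas_far|by apply: bmeasD => //; apply/bmeasZ/bmeasD|].
  by move=> x Xx; exact: far_le.
rewrite meanD//; last by apply/bmeasZ/bmeasD.
rewrite meanZ ?meanD//; last exact: bmeasD.
rewrite mean_cst !mean_sum; last 2 first.
- by move=> i; apply: bmeas_iter_odo; exact: bmeas_deviation.
- by move=> i; apply: bmeas_iter_odo; exact: bmeas_is_top.
have -> : \sum_(i < N) mean (fun x => is_top k.+2 (iter i T x)) =
    N%:R * (height k.+2)%:R^-1.
  rewrite (eq_bigr (fun=> (height k.+2)%:R^-1)); first by rewrite sumr_const card_ord mulr_natl.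
  by move=> i _; rewrite mean_iter_odo ?mean_is_top//; exact: bmeas_is_top.
have -> : \sum_(i < N) mean (fun x => deviation k (iter i T x)) =
    N%:R * (defect k.+2 + increment k.+1).
  rewrite (eq_bigr (fun=> defect k.+2 + increment k.+1)).
    by rewrite sumr_const card_ord mulr_natl.
  by move=> i _; rewrite mean_iter_odo ?mean_deviation//; exact: bmeas_deviation.
have g0 := @growth_gt0 R k.
have sq n : n.+2%:R^-1 <= (speed n)^-1 :> R.
  rewrite lef_pV2 ?posrE ?speed_gt0// -sqr_speed expr2 ler_peMl//.
    by rewrite ltW// speed_gt0.
  exact: speed_ge1.
have A : N%:R * (height k.+2)%:R^-1 <= e / 4.
  rewrite (@le_trans _ _ ((height k.+1)%:R * (height k.+2)%:R^-1))//.
    by rewrite ler_wpM2r ?invr_ge0// ltW.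
  rewrite mulrC height_ratio (le_trans (sq _))// (le_trans _ e1e)// n1P//.
  by rewrite leqW// (leq_trans (leq_addr n2 n1))// ltnW.
have B : defect k.+2 <= e2 * (4 * growth k).
  rewrite (le_trans (n2P _ _))//.
    by rewrite !leqW// (leq_trans (leq_addl n1 n2))// ltnW.
  rewrite ler_wpM2l ?(ltW e20)//.
  have := @growthS_le R k; have := @growthS_le R k.+1; lra.
have C : increment k.+1 <= e1 * growth k.
  rewrite /= mulrC ler_wpM2r ?(ltW g0)// n1P// (leq_trans (leq_addr n2 n1))// ltnW//.
have D : \sum_(j < k.+1) weight j <= N%:R * growth k * (2 * e1).
  rewrite kE; apply: (le_trans (sum_weight_le _)); rewrite -kE.
  have k'1 : (speed k')^-1 <= e1.
    by apply: n1P; rewrite (leq_trans (leq_addr n2 n1))// -ltnS -kE.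
  apply: ler_pM.
  - by rewrite mulr_ge0// ltW.
  - by rewrite addr_ge0 ?invr_ge0// ltW// speed_gt0.
  - by rewrite ler_wpM2r// ltW.
  - have q1 : k.+1%:R^-1 <= (speed k')^-1 :> R by rewrite kE; exact: sq.
    by rewrite mulr_natl mulr2n lerD// (le_trans q1).
have BCD : N%:R * (defect k.+2 + increment k.+1) + \sum_(j < k.+1) weight j <=
    delta * N%:R * growth k * (e / 4 + e / 4).
  have : N%:R * (defect k.+2 + increment k.+1) <= N%:R * (e2 * (4 * growth k) + e1 * growth k).
    by rewrite ler_wpM2l ?lerD// ltW.
  have : 3 * e1 * (N%:R * growth k) <= delta * e / 4 * (N%:R * growth k).
    rewrite ler_wpM2r//; first by rewrite mulr_ge0// ltW.
    by move: e1d; rewrite (mulrC e); lra.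
  have -> : N%:R * (e2 * (4 * growth k) + e1 * growth k) =
    (delta * e / 4 + e1) * (N%:R * growth k) by rewrite /e2; field.
  rewrite (_ : N%:R * growth k * (2 * e1) = 2 * e1 * (N%:R * growth k)) in D; last by ring.
  have -> : delta * N%:R * growth k * (e / 4 + e / 4) =
    2 * (delta * e / 4 * (N%:R * growth k)) by field.
  lra.
rewrite -[leRHS](_ : e / 4 + (e / 4 + e / 4 + e / 4) = _); last by field.
apply: lerD => //.
rewrite ler_pdivrMl ?mulr_gt0//; apply: (le_trans BCD).
by rewrite ler_wpM2l ?mulr_ge0// ?(ltW delta0) ?(ltW g0)// lerDl ltW// divr_gt0.
Qed.

(** * Lower bound for Birkhoff sums *)

Definition intact j k y : bool := [forall l : 'I_k, (j <= l)%N ==> (digit l y != 0%N)].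

Lemma intact_state j k y : (j <= k)%N -> intact j k y -> state j y = state k y.
Proof.
move=> jk /forallP H.
have {}H l : (j <= l)%N -> (l < k)%N -> digit l y != 0%N.
  by move=> jl lk; have := H (Ordinal lk); rewrite /= jl.
elim: k jk H => [|k IH]; first by rewrite leqn0 => /eqP->.
rewrite leq_eqVlt => /orP[/eqP->//|jk] H.
rewrite IH//; first by rewrite [LHS]state_rec (negPf (H k _ _)).
by move=> l jl lk; apply: H => //; rewrite ltnW.
Qed.

(** Every cap is at least 1, so a single renewal makes the left side nonpositive. The mean of the
    indicator is thus bounded below by means already computed. *)
Lemma intact_renewals j k y : 1 - renewals j k y <= (intact j k y)%:R.
Proof.
have r0 : 0 <= renewals j k y by exact: renewals_ge0.
have [_|/forallPn[l]] := boolP (intact j k y); first by rewrite lerBlDr lerDl.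
rewrite negb_imply negbK => /andP[jl dl].
rewrite lerBlDr add0r /renewals (bigD1 l)//= jl mul1r /renewed dl mulr1.
rewrite (le_trans (cap_ge1 l))// lerDl; apply: sumr_ge0 => i _.
exact: renewal_term_ge0.
Qed.

(** The spikes up to level [k] whose state is inherited from level [k], with the state divided out;
    what remains depends only on the position. *)
Definition core k y : R := \sum_(j < k.+1) weight j * (is_top j y * (intact j k y)%:R).

(** The function [core] as a function of the position, with the digits recovered from [t] by
    division. *)
Definition core_at k (t : nat) : R :=
  \sum_(j < k.+1) weight j *
    ((t %% height j == (height j).-1)%N%:R *
     [forall l : 'I_k, (j <= l)%N ==> (t %% height l.+1 %/ height l != 0)%N]%:R).

Lemma coreE k y : X y -> core k y = core_at k (position k y).
Proof.
move=> Xy; have y01 := Xy; rewrite unit_itvE in y01.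
apply: eq_bigr => j _; rewrite is_topE// (position_modm y01) -1?ltnS//.
congr (_ * (_ * _%:R)); congr nat_of_bool; apply: eq_forallb => l.
by rewrite (position_modm y01)// position_div.
Qed.

Lemma core_at_ge0 k t : 0 <= core_at k t.
Proof. by apply: sumr_ge0 => j _; rewrite mulr_ge0 ?weight_ge0// mulr_ge0. Qed.

Lemma sum_core_at k :
  (height k)%:R * (growth k - defect k) <= \sum_(t < height k) core_at k t.
Proof.
have bc : bmeas X (core k).
  by apply: eq_bmeas (bmeas_position k (core_at k)) => y Xy; rewrite coreE.
have -> : \sum_(t < height k) core_at k t = (height k)%:R * mean (core k).
  rewrite (eq_mean (g := fun y => core_at k (position k y))); last exact: coreE.
  by rewrite mean_position mulrA mulfV ?mul1r// heightR_neq0.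
rewrite ler_wpM2l// -(mean_top_renewals (leqnSn k)).
have bt j : bmeas X (fun y : R => weight j * is_top j y) by apply/bmeasZ/bmeas_is_top.
have bs : bmeas X (fun y : R => \sum_(j < k.+1) weight j * is_top j y) by exact: bmeas_sum.
have br : bmeas X (fun y : R => \sum_(j < k.+1) weight j * (is_top j y * renewals j k y)).
  by apply: bmeas_sum => j; exact: bmeas_top_renewals.
have -> : growth k = mean (fun y : R => \sum_(j < k.+1) weight j * is_top j y).
  rewrite mean_sum// -sum_increment; apply: eq_bigr => j _.
  by rewrite meanZ ?mean_is_top ?weightV//; exact: bmeas_is_top.
rewrite -meanB//; apply: le_mean => //; first exact: bmeasB.
move=> y _; rewrite -sumrB; apply: ler_sum => j _.
rewrite -mulrBr ler_wpM2l ?weight_ge0// -[X in X - _]mulr1 -mulrBr.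
by rewrite ler_wpM2l ?is_top_ge0// intact_renewals.
Qed.

Lemma spikes_ge_core k y : digit k y != 0%N -> state k.+1 y * core k y <= spikes y.
Proof.
move=> dk; apply: le_trans (spikes_ge vpos k.+1 y).
rewrite mulr_sumr; apply: ler_sum => j _.
have s0 := state_gt0 vpos j y.
rewrite mulrCA ler_wpM2l ?weight_ge0// mulrCA ler_wpM2l ?is_top_ge0//.
have [ij|_] := boolP (intact j k y); last by rewrite mulr0 ltW.
by rewrite mulr1 (intact_state _ ij) -1?ltnS// [leRHS]state_rec (negPf dk).
Qed.

Lemma birkhoff_window a n N x : (a + n <= N)%N ->
  birkhoff_sum T spikes n (iter a T x) <= birkhoff_sum T spikes N x.
Proof.
move=> anN; rewrite -(subnKC anN) /birkhoff_sum !big_split_ord/=.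
under eq_bigr do rewrite -iterD addnC.
have p (b : nat) (g : nat -> nat) : 0 <= \sum_(i < b) spikes (iter (g i) T x).
  by apply: sumr_ge0 => i _; rewrite ltW// spikes_gt0.
have := p a id; have := p (N - (a + n))%N (fun i => (a + n + i)%N).
lra.
Qed.

(** The segment stays in one (k + 1)-block and after its first k-block: [state k.+1] is constant and
    digit k never vanishes, so [spikes_ge_core] applies at each step and the core is summed over
    full periods. *)
Lemma birkhoff_block k n x : X x ->
  (height k <= position k.+1 x)%N -> (position k.+1 x + n <= height k.+1)%N ->
  state k.+1 x * ((n %/ height k)%:R * ((height k)%:R * (growth k - defect k))) <=
  birkhoff_sum T spikes n x.
Proof.
move=> Xx hk hn; have x01 := Xx; rewrite unit_itvE in x01.
have s0 := state_gt0 vpos k.+1 x.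
apply: (@le_trans _ _ (\sum_(i < n) state k.+1 x * core k (iter i T x))).
  rewrite -mulr_sumr ler_wpM2l ?(ltW s0)//.
  apply: (@le_trans _ _ ((n %/ height k)%:R * \sum_(t < height k) core_at k t)).
    by rewrite ler_wpM2l// sum_core_at.
  have /andP[h _] := cyclic_sum_bounds (position k x) n (height_gt0 k) (core_at_ge0 k).
  apply: (le_trans h); rewrite le_eqVlt; apply/orP; left; apply/eqP.
  apply: eq_bigr => i _; rewrite coreE ?position_iter//.
  by rewrite unit_itvE iter_odo_itv.
apply: ler_sum => i _.
have pi : (position k.+1 x + i < height k.+1)%N.
  by rewrite (leq_trans _ hn)// ltn_add2l.
rewrite -(block_invariant_iter (@block_invariant_state _ v k.+1) Xx pi).
apply: spikes_ge_core.
have Ti := iter_odo_itv i x01.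
rewrite -(position_div k Ti) position_iter// modn_small// -lt0n.
by rewrite divn_gt0 ?height_gt0// (leq_trans hk)// leq_addr.
Qed.

(** The (k + 1)-block of the midpoint contains the half before it or the half after it; dropping h_k
    steps at the start of that half leaves the first k-block of the block. *)
Lemma birkhoff_midpoint k N x : X x -> (16 * height k <= N)%N -> (N <= height k.+1)%N ->
  defect k <= growth k / 2 :> R ->
  state k.+1 (iter N./2 T x) * (N%:R * growth k / 8) <= birkhoff_sum T spikes N x.
Proof.
move=> Xx hN Nh dg; have x01 := Xx; rewrite unit_itvE in x01.
set m := N./2; set z := iter m T x; set n := (m - height k)%N.
have h0 := height_gt0 k.
have mN : (m + m <= N)%N by rewrite addnn -[leqRHS]odd_double_half leq_addl.
have Nm : (N <= m + m + 1)%N.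
  by rewrite addnn -[leqLHS]odd_double_half addnC leq_add2l leq_b1.
have z01 : 0 <= z < 1 by exact: iter_odo_itv.
have sz := state_gt0 vpos k.+1 z.
have window a : (a + n <= N)%N -> state k.+1 (iter a T x) = state k.+1 z ->
    (height k <= position k.+1 (iter a T x))%N ->
    (position k.+1 (iter a T x) + n <= height k.+1)%N ->
    state k.+1 z * (N%:R * growth k / 8) <= birkhoff_sum T spikes N x.
  move=> aN sa pa1 pa2; apply: le_trans (@birkhoff_window a n N x aN).
  have Xa : X (iter a T x) by rewrite unit_itvE iter_odo_itv.
  apply: le_trans (birkhoff_block Xa pa1 pa2); rewrite sa ler_wpM2l ?(ltW sz)//.
  (* From N / 2 at most two lengths h_k are lost, up to parity: one by the dropped steps and one by
     rounding to full periods. *)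
  have nh : (N <= 4 * (n %/ height k * height k))%N.
    have := divn_eq n (height k); have := ltn_pmod n h0.
    rewrite /n; move: (_ %/ _ * _)%N (_ %% _)%N => Q r.
    by move: hN Nm h0; move: (height k) => h; lia.
  have nhR : N%:R <= 4 * ((n %/ height k)%:R * (height k)%:R) :> R.
    by rewrite -natrM -[4]/(4%:R) -natrM ler_nat.
  have g2 : growth k / 2 <= growth k - defect k :> R by move: dg; lra.
  have g0 := @growth_gt0 R k.
  rewrite mulrA (@le_trans _ _ ((n %/ height k)%:R * (height k)%:R * (growth k / 2)))//.
    have : N%:R * growth k <= 4 * ((n %/ height k)%:R * (height k)%:R) * growth k :> R.
      by rewrite ler_wpM2r// ltW.
    by set A := _%:R * _%:R; lra.
  by rewrite ler_wpM2l// mulr_ge0.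
have tz := position_lt k.+1 z01.
(* If the midpoint has position at least m, the window ends at it; otherwise the window starts h_k
   steps after it and fits because N <= h_(k + 1). *)
have [tm|tm] := leqP m (position k.+1 z).
- have nz : iter n T (iter (m - n) T x) = z.
    by rewrite -iterD subnKC// leq_subr.
  set a := (m - n)%N in nz *; have a01 := iter_odo_itv a x01.
  have pa := position_iter k.+1 n a01; rewrite nz in pa.
  have la := position_lt k.+1 a01.
  have nm : (n <= m)%N by exact: leq_subr.
  have pE : (position k.+1 (iter a T x) + n = position k.+1 z)%N.
    move: pa; have [lt|ge] := ltnP (position k.+1 (iter a T x) + n) (height k.+1).
      by rewrite modn_small.
    by rewrite -[X in (X %% _)%N](subnK ge) modnDr modn_small;
      clear -nm la tz tm ge; lia.
  apply: (window a).
  + by rewrite /a subnK// (leq_trans _ mN)// leq_addr.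
  + have Xa : X (iter a T x) by rewrite unit_itvE.
    rewrite -nz (block_invariant_iter (@block_invariant_state _ v k.+1) Xa)//.
    by rewrite pE.
  + by clear -pE tm hN Nm h0; lia.
  + by rewrite pE ltnW.
- have hm : (height k <= m)%N by lia.
  have Xz : X z by rewrite unit_itvE.
  have pz : (position k.+1 z + height k < height k.+1)%N by lia.
  have aE : iter (height k + m) T x = iter (height k) T z by rewrite iterD.
  have pE : position k.+1 (iter (height k) T z) = (position k.+1 z + height k)%N.
    by rewrite position_iter// modn_small.
  apply: (window (height k + m)%N); rewrite ?aE ?pE.
  + by rewrite /n; lia.
  + exact: (block_invariant_iter (@block_invariant_state _ v k.+1) Xz).
  + by rewrite leq_addl.
  + by rewrite /n; lia.
Qed.

Lemma birkhoff_lower : exists N0, forall N, (N0 <= N)%N -> exists J p,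
  forall x, X x ->
    state J (iter p T x) * norming N%:R <= 256 * birkhoff_sum T spikes N x.
Proof.
have [n0 n0P] := @defect_small R (1 / 2) (divr_gt0 ltr01 (ltr0n R 2)).
exists (16 * height (n0 + 16))%N => N hN.
have t1 : 1 <= N%:R / 16 :> R.
  rewrite ler_pdivlMr// mul1r -[16]/(16%:R) ler_nat (leq_trans _ hN)//.
  by rewrite leq_pmulr// height_gt0.
(* Thus 16 h_k <= N < 16 h_(k + 1). The bound [n0 + 16 <= k] makes consecutive heights differ by a
   factor of at least 16. *)
pose k := scale (N%:R / 16 : R).
have /andP[hk1 hk2] := scale_itv t1; rewrite -/k in hk1 hk2.
have kn : (n0 + 16 <= k)%N.
  rewrite -height_le_scale// ler_pdivlMr// -[16]/(16%:R) -natrM ler_nat mulnC.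
  by rewrite mulnC (leq_trans _ hN)// mulnC.
have hkN : (16 * height k <= N)%N.
  by move: hk1; rewrite ler_pdivlMr// -[16]/(16%:R) -natrM ler_nat mulnC.
have hkN2 : (N < 16 * height k.+1)%N.
  by move: hk2; rewrite ltr_pdivrMr// -[16]/(16%:R) -natrM ltr_nat mulnC.
have dg : defect k <= growth k / 2 :> R.
  by rewrite mulrC -[2^-1]mul1r n0P// (leq_trans (leq_addr 16 n0)).
(* [N'] is at least N / 16 and fits [birkhoff_midpoint]. The factor 256 is 16 from [N'], 2 from
   [growth] at the scale of [N], and 8 from the midpoint bound. *)
pose N' := minn N (height k.+1).
exists k.+1, N'./2 => x Xx.
have h1 : (16 * height k <= N')%N.
  by rewrite leq_min hkN heightS leq_mul2r; apply/orP; right; lia.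
have := birkhoff_midpoint Xx h1 (geq_minr _ _) dg.
set s := state _ _ => mid.
have s0 : 0 < s by exact: state_gt0.
have mono : birkhoff_sum T spikes N' x <= birkhoff_sum T spikes N x.
  by have := @birkhoff_window 0 N' N x (geq_minl _ _).
have N16 : (N <= 16 * N')%N by rewrite /N'; lia.
have N16R : N%:R <= 16 * N'%:R :> R by rewrite -[16]/(16%:R) -natrM ler_nat.
have gs : growth (scale (N%:R : R)) <= 2 * growth k :> R.
  apply: le_trans (growthS_le k); apply: le_growth.
  rewrite leqNgt -height_le_scale; last by rewrite ler1n; have := height_gt0 k; lia.
  rewrite ler_nat -ltnNge (leq_trans hkN2)// (heightS k.+1) leq_mul2r.
  by apply/orP; right; lia.
have g0 := @growth_gt0 R k.
have : norming N%:R <= 32 * (N'%:R * growth k) :> R.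
  rewrite /norming (@le_trans _ _ (16 * N'%:R * (2 * growth k)))//.
    by rewrite ler_pM// ltW// growth_gt0.
  by rewrite le_eqVlt; apply/orP; left; apply/eqP; ring.
move=> /(ler_wpM2l (ltW s0)) h.
apply: (le_trans h).
have -> : s * (32 * (N'%:R * growth k)) = 256 * (s * (N'%:R * growth k / 8)) by field.
by apply: ler_wpM2l => //; exact: le_trans mid mono.
Qed.

End Bounds.

(** * Mixing *)

Section Mixing.
Context {R : realType}.
Local Notation mu := (@lebesgue_measure R).
Local Notation RR := (measurableTypeR R).
Local Notation X := (@unit_itv R : set RR).
Local Notation T := (@odo R).
Implicit Types (x y e : R) (k l n N : nat).

Local Hint Resolve measurable_unit_itv mu_unit_itv_lty : core.

(** Uniform continuity by compactness, with only [x] confined to the segment; this is possible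
    because [f] is continuous there as a function on the line. *)
Lemma heine (f : R -> R) (a b e : R) :
    (forall x, a <= x <= b -> {for x, continuous f}) -> 0 < e ->
  exists2 delta : R, 0 < delta &
    forall x y, a <= x <= b -> `|x - y| < delta -> `|f x - f y| <= e.
Proof.
move=> cf e0; have /compact_near_coveringP cov := @segment_compact R a b.
have [] := cov R (0^'+) (fun delta x => forall y, `|x - y| < delta -> `|f x - f y| <= e).
  move=> x /=; rewrite in_itv/= => /cf /cvgrPdist_lt/(_ (e / 2)).
  rewrite divr_gt0// => /(_ isT) [r /= r0 fr].
  have r20 : 0 < r / 2 by rewrite divr_gt0.
  exists (ball x (r / 2), [set delta | delta < r / 2]) => /=.
    split; first exact: nbhsx_ballx.
    exact: nbhs_right_lt.
  move=> [x' delta] /= [xx' dr] y yd.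
  have h1 : `|f x - f x'| < e / 2.
    by apply: fr; rewrite /= (lt_trans xx')// gtr_pMr// invf_lt1// ltr1n.
  have h2 : `|f x - f y| < e / 2.
    apply: fr => /=; rewrite -(subrKA x') (le_lt_trans (ler_normD _ _))//.
    have : `|x - x'| < r / 2 by exact: xx'.
    have : `|x' - y| < r / 2 by rewrite (lt_trans yd).
    lra.
  rewrite -(subrKA (f x)) (le_trans (ler_normD _ _))// -(distrC (f x)).
  lra.
move=> r /= r0 Pr; exists (r / 2); first by rewrite divr_gt0.
move=> x y xab; apply: (Pr (r / 2)).
- by rewrite /= sub0r normrN gtr0_norm ?divr_gt0// gtr_pMr// invf_lt1// ltr1n.
- by rewrite divr_gt0.
- by rewrite /= in_itv.
Qed.

Lemma bmeas_continuous (u : R -> R) : continuous u -> bmeas X u.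
Proof.
move=> cu; split; first by apply: measurable_funTS; exact: continuous_measurable_fun.
have : compact (u @` `[0, 1]%classic).
  apply: continuous_compact; last exact: segment_compact.
  exact: continuous_subspaceT.
move=> /compact_bounded[C [_ HC]]; exists (C + 1) => x; rewrite unit_itvE => /andP[x0 x1].
by apply: (HC (C + 1)); [rewrite ltrDl|exists x => //=; rewrite in_itv/= x0 ltW].
Qed.

Lemma mean_norm_le (f g : R -> R) : bmeas X f -> bmeas X g ->
  (forall x, X x -> `|f x| <= g x) -> `|mean f| <= mean g.
Proof.
move=> bf bg fg; rewrite (le_trans (mean_norm bf))//.
by apply: le_mean => //; exact: bmeas_norm.
Qed.

(** On a high tower [u] is uniformly close to its values at the left ends of the levels, a function
    of the position, which is independent of [psi] by [mean_block]. *)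
Lemma mixing (u : R -> R) (C e : R) : continuous u -> 0 < e ->
  exists n, forall (psi : R -> R), bmeas X psi -> (forall x, `|psi x| <= C) ->
    block_invariant n psi -> `|mean (fun x => u x * psi x) - mean u * mean psi| <= e.
Proof.
move=> cu e0.
pose e1 := e / (2 * (`|C| + 1)).
have C1 : 0 < `|C| + 1 by rewrite ltr_wpDl.
have e10 : 0 < e1 by rewrite divr_gt0// mulr_gt0.
have [delta d0 dP] := heine (fun x (_ : 0 <= x <= 1) => cu x) e10.
have [n nd] : exists n, (height n)%:R^-1 < delta.
  have := cvgr_lt 0 (@cvg_heightV R) delta d0.
  by move=> [n _ /(_ n (leqnn n)) nd]; exists n.
exists n => psi bpsi psiC inv.
pose un x := u (left_end n (position n x)).
have bu := bmeas_continuous cu.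
have bun : bmeas X un by exact: (bmeas_position n (fun t => u (left_end n t))).
have uun x : X x -> `|u x - un x| <= e1.
  rewrite unit_itvE => x01; apply: dP; first by case/andP: x01 => -> /ltW.
  have /andP[t0 t1] := tail_itv n x01.
  rewrite {1}(left_end_position n x01) addrAC subrr add0r.
  rewrite ger0_norm ?divr_ge0//.
  by apply: lt_trans nd; rewrite gtr_pMl// heightV_gt0.
have E : mean (fun x => un x * psi x) = mean un * mean psi.
  rewrite (mean_block (fun t => u (left_end n t)) bpsi inv).
  by rewrite (mean_position n (fun t => u (left_end n t))).
have -> : mean (fun x => u x * psi x) - mean u * mean psi =
    mean (fun x => (u x - un x) * psi x) - mean (fun x => u x - un x) * mean psi.
  rewrite [in RHS]meanB// mulrBl -E -[mean (fun x => (u x - un x) * _)](_ :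
    mean (fun x => u x * psi x) - mean (fun x => un x * psi x) = _); first by ring.
  rewrite -meanB; [|exact: bmeasM|exact: bmeasM].
  by apply: eq_mean => x _; rewrite mulrBl.
have bd : bmeas X (fun x => u x - un x) by exact: bmeasB.
have C0 : 0 <= C by rewrite (le_trans (normr_ge0 _) (psiC 0)).
have h1 : `|mean (fun x => (u x - un x) * psi x)| <= e1 * C.
  rewrite -[leRHS]mean_cst; apply: mean_norm_le; [exact: bmeasM|exact: bmeas_cst|].
  by move=> x Xx; rewrite normrM ler_pM// uun.
have h2 : `|mean (fun x => u x - un x) * mean psi| <= e1 * C.
  rewrite normrM ler_pM//.
    by rewrite -[leRHS]mean_cst; apply: mean_norm_le => //; exact: bmeas_cst.
  by rewrite -[leRHS]mean_cst; apply: mean_norm_le => //; exact: bmeas_cst.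
rewrite (le_trans (ler_normB _ _))// (le_trans (lerD h1 h2))//.
have : e1 * (`|C| + 1) = e / 2 by rewrite /e1; field; rewrite gt_eqF.
rewrite (ger0_norm C0); have := ltW e10; lra.
Qed.

Lemma exists_density (Q : probability RR R) : Q `<< mu -> exists q : R -> R,
  mu.-integrable X (EFin \o q) /\
  forall h : R -> R, bmeas X h ->
    (\int[Q]_(x in X) (h x)%:E)%E = (mean (fun x => h x * q x))%:E.
Proof.
move=> Qmu; pose D := Radon_Nikodym (charge_of_finite_measure Q) mu.
have Dfin x : D x \is a fin_num by exact: Radon_Nikodym_fin_num.
have DE : D = EFin \o (fine \o D) by apply/funext => x /=; rewrite fineK.
have iD : mu.-integrable X D.
  apply: (integrableS (E := setT)) => //.
  exact: Radon_Nikodym_integrable.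
exists (fine \o D); split; first by rewrite -DE.
move=> h bh.
have iQ : Q.-integrable X (EFin \o h).
  apply: bmeas_integrable bh => //.
  by rewrite (le_lt_trans (probability_le1 _ _))// ltry.
rewrite -(Radon_Nikodym_change_of_variables Qmu _ iQ)// /mean /Rintegral fineK.
  by apply: eq_integral => x _ /=; rewrite EFinM fineK.
apply: integrable_fin_num => //.
have [mh [C hC]] := bh.
have := @integrableMr _ _ _ mu X _ h D mh _ iD.
rewrite (_ : ((EFin \o h) \* D)%E = fun x => (h x * fine (D x))%:E); last first.
  by apply/funext => x /=; rewrite EFinM fineK.
apply => //; exists `|C|; split; first exact: num_real.
by move=> M CM x Xx; rewrite /= (le_trans (hC x Xx))// (le_trans (ler_norm C))// ltW.
Qed.

Lemma mean_density_close (q u h : R -> R) (C : R) :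
  mu.-integrable X (EFin \o q) -> bmeas X u -> bmeas X h -> (forall x, `|h x| <= C) ->
  `|mean (fun x => h x * q x) - mean (fun x => h x * u x)| <=
  C * mean (fun x => `|q x - u x|).
Proof.
move=> iq bu bh hC.
have C0 : 0 <= C by rewrite (le_trans (normr_ge0 _) (hC 0)).
have iu := bmeas_int bu.
have iqu : mu.-integrable X (EFin \o (fun x => q x - u x)).
  by have := integrableB measurable_unit_itv iq iu.
have ihqu (k : R -> R) : mu.-integrable X (EFin \o k) ->
    mu.-integrable X (EFin \o (fun x => h x * k x)).
  move=> ik; have [mh [B hB]] := bh.
  have := @integrableMr _ _ _ mu X _ h (EFin \o k) mh _ ik.
  apply => //; exists `|B|; split; first exact: num_real.
  by move=> M CM x Xx; rewrite /= (le_trans (hB x Xx))// (le_trans (ler_norm B))// ltW.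
rewrite /mean -RintegralB//; [|exact: ihqu|exact: ihqu].
under eq_Rintegral do rewrite -mulrBr.
rewrite (le_trans (le_normr_Rintegral _ _))//; first exact: ihqu.
rewrite -RintegralZl//; last exact: integrable_norm.
apply: le_Rintegral => //.
- by apply: integrable_norm; exact: ihqu.
- have := @integrableZl _ _ _ mu X measurable_unit_itv C _ (integrable_norm iqu).
  by apply: eq_integrable => // x _ /=; rewrite EFinM.
- by move=> x _; rewrite normrM ler_wpM2r.
Qed.

(* Convergence in [mu]-probability to block-invariant functions is turned into
   convergence of integrals against any density, since a continuous density
   hardly varies on the levels of a high tower. *)
Lemma mixing_density (q : R -> R) (h psi : nat -> R -> R) (K : nat -> nat) (C c : R) :
    mu.-integrable X (EFin \o q) ->
    (forall N, bmeas X (h N)) -> (forall N, bmeas X (psi N)) ->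
    (forall N x, `|h N x| <= C) -> (forall N x, `|psi N x| <= C) ->
    (forall N, block_invariant (K N) (psi N)) ->
    (forall n, exists N0, forall N, (N0 <= N)%N -> (n <= K N)%N) ->
    (forall e, 0 < e -> exists N0, forall N, (N0 <= N)%N ->
       mean (fun x => `|h N x - psi N x|) <= e) ->
    (forall e, 0 < e -> exists N0, forall N, (N0 <= N)%N ->
       `|mean (psi N) - c| <= e) ->
  forall e, 0 < e -> exists N0, forall N, (N0 <= N)%N ->
    `|mean (fun x => h N x * q x) - c * mean q| <= e.
Proof.
move=> iq bh bpsi hC psiC inv Kinf hpsi psic e e0.
have C0 : 0 <= C by rewrite (le_trans (normr_ge0 _) (hC 0%N 0)).
pose A := 2 * C + 2 * `|c| + 2; have A0 : 0 < A.
  by rewrite /A; have := normr_ge0 c; lra.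
pose e1 := e / (4 * A).
have e10 : 0 < e1 by rewrite divr_gt0// mulr_gt0.
have mq : measurable_fun X (q : RR -> R) by case/integrableP : iq => /measurable_EFinP.
(* Continuous functions are dense in L1: the density is replaced by a continuous [u], to which
   [mixing] applies. *)
have [g [cg ig gq]] := approximation_continuous_integrable measurable_unit_itv mu_unit_itv_lty iq.
have [u cu qu] : exists2 u : R -> R, continuous u & mean (fun x => `|q x - u x|) <= e1.
  have [n _ /(_ n (leqnn n)) /= H] := cvgr_lt 0 (fine_cvg gq) e1 e10.
  by exists (g n) => //; exact: ltW.
have bu := bmeas_continuous cu.
have [B uB] := bu.2.
have B0 : 0 < `|B| + 1 by rewrite ltr_wpDl.
have [n nP] := mixing C cu e10.
have [N1 N1P] := Kinf n.
have [N2 N2P] := hpsi (e1 / (`|B| + 1)) (divr_gt0 e10 B0).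
have U0 : 0 < `|mean u| + 1 by rewrite ltr_wpDl.
have [N3 N3P] := psic (e1 / (`|mean u| + 1)) (divr_gt0 e10 U0).
exists (maxn N1 (maxn N2 N3)) => N; rewrite !geq_max => /and3P[hN1 hN2 hN3].
have h1 := mean_density_close iq bu (bh N) (hC N).
have h2 : `|mean (fun x => h N x * u x) - mean (fun x => u x * psi N x)| <= e1.
  rewrite -meanB; [|exact: bmeasM|exact: bmeasM].
  apply: (@le_trans _ _ ((`|B| + 1) * mean (fun x => `|h N x - psi N x|))); last first.
    by rewrite -ler_pdivlMl// mulrC N2P.
  rewrite -meanZ; last by apply/bmeas_norm/bmeasB.
  apply: mean_norm_le.
  - by apply: bmeasB; exact: bmeasM.
  - by apply/bmeasZ/bmeas_norm/bmeasB.
  move=> x Xx; rewrite mulrC -mulrBr normrM ler_wpM2r// (le_trans (uB x Xx))//.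
  by rewrite (le_trans (ler_norm _))// lerDl.
have h3 := nP _ (bpsi N) (psiC N) (block_invariant_le (N1P N hN1) (inv N)).
have h4 : `|mean u * mean (psi N) - mean u * c| <= e1.
  rewrite -mulrBr normrM.
  apply: (@le_trans _ _ ((`|mean u| + 1) * `|mean (psi N) - c|)).
    by rewrite ler_wpM2r// lerDl.
  by rewrite -ler_pdivlMl// mulrC N3P.
have h5 : `|mean q - mean u| <= e1.
  have := @mean_density_close q u (fun=> 1) 1 iq bu (bmeas_cst _ 1).
  rewrite mul1r => /(_ (fun _ => _)) H.
  rewrite (@eq_mean _ q (fun x => 1 * q x)); last by move=> x _; rewrite mul1r.
  rewrite (@eq_mean _ u (fun x => 1 * u x)); last by move=> x _; rewrite mul1r.
  by apply: le_trans qu; apply: H; rewrite normr1.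
have h6 : `|c * mean u - c * mean q| <= `|c| * e1.
  by rewrite -mulrBr normrM ler_wpM2l// distrC.
have h1' : C * mean (fun x => `|q x - u x|) <= C * e1 by rewrite ler_wpM2l.
(* Five exchanges in turn: [q] by [u], [h] by [psi], the mean of the product by the product of
   means, the mean of [psi] by [c], and [u] back to [q]. *)
have -> : mean (fun x => h N x * q x) - c * mean q =
  (mean (fun x => h N x * q x) - mean (fun x => h N x * u x)) +
  (mean (fun x => h N x * u x) - mean (fun x => u x * psi N x)) +
  (mean (fun x => u x * psi N x) - mean u * mean (psi N)) +
  (mean u * mean (psi N) - mean u * c) + (c * mean u - c * mean q) by ring.
have tot : C * e1 + e1 + e1 + e1 + `|c| * e1 <= e.
  have e1E : e1 * (4 * A) = e by rewrite /e1 divfK// gt_eqF// mulr_gt0.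
  have c0 := normr_ge0 c; rewrite -e1E /A; nra.
apply: le_trans tot.
rewrite (le_trans (ler_normD _ _))// lerD//.
rewrite (le_trans (ler_normD _ _))// lerD//.
rewrite (le_trans (ler_normD _ _))// lerD//.
rewrite (le_trans (ler_normD _ _))// lerD//.
exact: le_trans h1 h1'.
Qed.

End Mixing.

(** * Limit law and lower tail *)

Section Limit.
Context (R : realType) d (Omega : measurableType d) (P : probability Omega R).
Context (Y : {RV P >-> R}) (Ypos : forall w, 0 < Y w) (v : R -> R).
Local Notation mu := (@lebesgue_measure R).
Local Notation RR := (measurableTypeR R).
Local Notation X := (@unit_itv R : set RR).
Local Notation T := (@odo R).
Hypotheses (mv : measurable_fun [set: RR] (v : RR -> RR)) (vpos : forall u, 0 < v u).
Hypothesis lawv : forall A : set RR, measurable A -> mu (X `&` v @^-1` A) = P (Y @^-1` A).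
Implicit Types (x y e : R) (k l n N : nat).

Local Hint Resolve measurable_unit_itv mu_unit_itv_lty : core.

Let mv' : measurable_fun [set: RR] (v : RR -> R).
Proof. exact: mv. Qed.

Lemma mean_bool (b : R -> bool) : measurable_fun X (b : RR -> bool) ->
  (mean (fun x => (b x)%:R))%:E = mu (X `&` [set x | b x]).
Proof.
move=> mb; have mB : measurable (X `&` [set x | b x] : set RR).
  have := mb measurable_unit_itv [set true] I.
  by congr measurable; apply/seteqP; split.
rewrite -[in RHS](setIid X) -setIA -mean_indic//; congr EFin.
apply: eq_mean => x Xx; rewrite indicE; congr (nat_of_bool _)%:R.
by apply/idP/idP => [bx|/set_mem[]//]; apply/mem_set.
Qed.

(** Since s <= 1 <= [cap i], capping does not affect the event of being below [s], so
    [mean_state_le] yields a bound without error term. *)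
Lemma state_lower_tail l (s : R) : s <= 1 ->
  ((mean (fun x => (state v l x < s)%R%:R))%:E <= P [set w | (Y w <= s)%R])%E.
Proof.
move=> s1.
have mlt : measurable_fun [set: RR] (fun t : RR => (t < s : bool)).
  by apply: measurable_fun_ltr => //; exact: measurable_cst.
have H : mean (fun x => (state v l x < s)%R%:R) <= mean (fun x => (v x < s)%R%:R).
  have bphi : bmeasT (fun t : R => (t < s)%R%:R : R).
    split; first by have [] := @bmeas_bool _ _ R _ _ mlt.
    by exists 1 => t; case: (t < s); rewrite ?normr1 ?normr0.
  apply: (mean_state_le mv bphi) => i li.
  rewrite le_eqVlt; apply/orP; left; apply/eqP; apply: eq_mean => x _.
  by rewrite gt_min [cap i < s]ltNge (le_trans s1 (cap_ge1 i)) orbF.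
rewrite (@le_trans _ _ (mean (fun x => (v x < s)%R%:R))%:E)// mean_bool; last first.
  apply: measurable_funTS; exact: (measurableT_comp mlt mv').
have -> : X `&` [set x | v x < s] = X `&` v @^-1` `]-oo, s[%classic.
  by apply/seteqP; split=> x [Xx] /=; rewrite in_itv.
rewrite lawv; last exact: measurable_itv.
rewrite le_measure ?inE//.
- exact: measurable_funPTI.
- have := measurable_funPTI Y (measurable_itv `]-oo, s]).
  by congr measurable; apply/seteqP; split=> w /=; rewrite in_itv.
- by move=> w /=; rewrite in_itv/= => /ltW.
Qed.

(** A small Birkhoff sum forces a small state at the shifted point; the shift does not depend on [x]
    and preserves the measure, so [state_lower_tail] concludes. *)
Lemma birkhoff_lower_tail : exists N0, forall N, (N0 <= N)%N ->
  forall a : R, 0 < a < 256^-1 ->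
  (mu (X `&` [set x | (birkhoff_sum T (spikes v) N x < a * norming N%:R)%R]) <=
   P [set w | (Y w <= 256 * a)%R])%E.
Proof.
have [N0 N0P] := birkhoff_lower vpos; exists N0.+1 => N hN a /andP[a0 a1].
have [J [p Jp]] := N0P N (ltnW hN).
have b0 : 0 < norming (N%:R : R).
  by apply: norming_gt0; rewrite ltr0n (leq_ltn_trans _ hN).
have s1 : 256 * a <= 1 by rewrite -ler_pdivlMl// mulr1 ltW.
apply: le_trans (state_lower_tail J s1).
have bs : measurable_fun X (fun x : RR => state v J x < 256 * a).
  by apply: measurable_fun_ltr; [exact: measurable_state|exact: measurable_cst].
have mit := measurable_iter_odo (f := state v J) p (measurable_state mv J).
rewrite -(mean_iter_odo p (@bmeas_bool _ _ R _ _ bs)) mean_bool; last first.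
  by apply: measurable_fun_ltr => //; exact: measurable_cst.
rewrite le_measure ?inE//.
- have mb := measurable_birkhoff mv N.
  have := measurable_fun_ltr mb (measurable_cst (a * norming N%:R : R)).
  move=> /(_ measurable_unit_itv [set true] I).
  by congr measurable; apply/seteqP; split.
- have := measurable_fun_ltr mit (measurable_cst (256 * a : R)).
  move=> /(_ measurable_unit_itv [set true] I).
  by congr measurable; apply/seteqP; split.
- move=> x [Xx] /= Sa; split=> //=.
  have := Jp x Xx => h.
  have : state v J (iter p T x) * norming N%:R < 256 * a * norming N%:R.
    by rewrite (le_lt_trans h)// -mulrA ltr_pM2l.
  by rewrite ltr_pM2r.
Qed.

Lemma mean_gt_cap_small e : 0 < e -> exists l0, forall l, (l0 <= l)%N ->
  mean (fun x => (cap l < v x)%R%:R) <= e.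
Proof.
move=> e0; have [a [b [a0 ab H]]] := law_tight mv vpos e0.
have [l0 l0P] := cap_large b; exists l0 => l /l0P bl.
apply: le_trans H; apply: le_mean.
- apply: bmeas_bool; apply: measurable_funTS; apply: measurable_fun_ltr => //.
- apply: bmeas_bool; apply: measurable_funTS; apply: measurable_neg; apply: measurable_and;
    by apply: measurable_fun_ler.
move=> x _; rewrite ler_nat; have [h|//] := ltP (cap l) (v x).
by rewrite andbC leNgt (le_lt_trans bl h).
Qed.

Lemma reference_large n : exists N0, forall N, (N0 <= N)%N -> (n <= @reference R N)%N.
Proof.
exists (height n) => N hN; rewrite /reference !leqW//.
by rewrite -height_le_scale ?ler_nat// ler1n (leq_trans (height_gt0 n)).
Qed.

Lemma mean_state_limit (phi : R -> R) (C : R) : measurable_fun [set: RR] (phi : RR -> R) ->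
  (forall t, `|phi t| <= C) -> forall e, 0 < e -> exists N0, forall N, (N0 <= N)%N ->
  `|mean (fun x => phi (state v (@reference R N) x)) - mean (fun x => phi (v x))| <= e.
Proof.
move=> mphi phiC e e0.
have C0 : 0 <= C by rewrite (le_trans (normr_ge0 _) (phiC 0)).
have C1 : 0 < 2 * C + 1 by rewrite ltr_wpDl// mulr_ge0.
have [l0 l0P] := mean_gt_cap_small (divr_gt0 e0 C1).
have [N0 N0P] := reference_large l0; exists N0 => N /N0P/l0P h.
apply: (le_trans (mean_state_cvg mv _ mphi phiC)).
apply: (@le_trans _ _ ((2 * C + 1) * mean (fun x => (cap (@reference R N) < v x)%R%:R))).
  by rewrite ler_wpM2r ?lerDl// mean_ge0.
by rewrite -ler_pdivlMl// mulrC.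
Qed.

(** By tightness the state mostly lies in a segment [a, b] of positive numbers, near which [g] is
    uniformly continuous; off that event and on [far] the difference is at most 2 C. *)
Lemma normalized_close (g : R -> R) (C : R) : measurable_fun [set: RR] (g : RR -> R) ->
    (forall t, `|g t| <= C) -> (forall t, 0 < t -> {for t, continuous g}) ->
  forall e, 0 < e -> exists N0, forall N, (N0 <= N)%N ->
    mean (fun x => `|g (normalized v N x) - g (state v (@reference R N) x)|) <= e.
Proof.
move=> mg gC cg e e0.
have C0 : 0 <= C by rewrite (le_trans (normr_ge0 _) (gC 0)).
pose e1 := e / (1 + 8 * C).
have D0 : 0 < 1 + 8 * C by lra.
have e10 : 0 < e1 by rewrite divr_gt0.
have [a [b [a0 ab H]]] := law_tight mv vpos e10.
have b0 : 0 < b by rewrite (lt_le_trans a0).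
pose out t : bool := ~~ (a <= t <= b).
have mout : measurable_fun [set: RR] (fun t : RR => (out t)%:R : R).
  have [] // := @bmeas_bool _ RR R setT out.
  apply: measurable_neg; apply: measurable_and; apply: measurable_fun_ler => //;
    exact: measurable_cst.
have outC t : `|(out t)%:R| <= 1 :> R by case: (out t); rewrite ?normr1 ?normr0.
have [N1 N1P] := mean_state_limit mout outC e10.
have cab t : a <= t <= b -> {for t, continuous g}.
  by move=> /andP[h _]; apply: cg; rewrite (lt_le_trans a0).
have [delta d0 dP] := heine cab e10.
(* For a state at most [b], the relative tolerance of [far] is then at most delta / 2. *)
pose delta' := delta / (2 * (1 + b)).
have b10 : 0 < 1 + b by rewrite addr_gt0.
have d'0 : 0 < delta' by rewrite divr_gt0// mulr_gt0.
have [N2 N2P] := normalized_far_small mv vpos d'0 e10.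
exists (maxn N1 N2) => N; rewrite geq_max => /andP[/N1P h1 /N2P h2].
set K := reference N in h1 *.
have bstate (phi : R -> R) : measurable_fun [set: RR] (phi : RR -> R) ->
    (exists B : R, forall t, `|phi t| <= B) -> bmeas X (fun x => phi (state v K x)).
  by move=> mphi phiB; apply: (bmeas_state mv K); split.
have bn : bmeas X (fun x => g (normalized v N x)).
  split; last by exists C => x _; exact: gC.
  by apply: (measurableT_comp mg); exact: measurable_normalized.
have bs : bmeas X (fun x => g (state v K x)) by apply: bstate => //; exists C.
have bo : bmeas X (fun x => (out (state v K x))%:R : R).
  by apply: (bstate (fun t => (out t)%:R)) => //; exists 1.
have bf := bmeas_far mv delta' N.
have bR : bmeas X (fun x => e1 + 2 * C * ((far v delta' N x)%:R + (out (state v K x))%:R)).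
  by apply: bmeasD; [exact: bmeas_cst|apply/bmeasZ/bmeasD].
apply: (@le_trans _ _ (mean (fun x =>
    e1 + 2 * C * ((far v delta' N x)%:R + (out (state v K x))%:R)))).
  apply: le_mean => //; first by apply/bmeas_norm/bmeasB.
  move=> x Xx; have s0 := state_gt0 vpos K x.
  have triv : `|g (normalized v N x) - g (state v K x)| <= 2 * C.
    by rewrite (le_trans (ler_normB _ _))// mulr_natl mulr2n lerD.
  have [fx|nf] := boolP (far v delta' N x).
    apply: (le_trans triv); rewrite -[leLHS]add0r lerD ?(ltW e10)//.
    by rewrite ler_peMr ?mulr_ge0// lerDl.
  rewrite add0r; have [ox|] := boolP (out (state v K x)).
    by apply: (le_trans triv); rewrite mulr1 lerDr ltW.
  rewrite negbK mulr0 addr0 => sab; rewrite distrC; apply: dP => //.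
  move: nf; rewrite /far -leNgt -/K distrC => /le_lt_trans; apply.
  have : delta' * (1 + state v K x) <= delta' * (1 + b).
    by rewrite ler_pM2l// lerD2l; case/andP: sab.
  have -> : delta' * (1 + b) = delta / 2 by rewrite /delta'; field; rewrite gt_eqF.
  lra.
rewrite meanD; [|exact: bmeas_cst|by apply/bmeasZ/bmeasD].
rewrite mean_cst meanZ ?meanD//; last exact: bmeasD.
have h3 : mean (fun x => (out (state v K x))%:R) <= 2 * e1.
  move: h1; rewrite ler_distl => /andP[_]; have : mean (fun x => (out (v x))%:R) <= e1 by exact: H.
  lra.
have : 2 * C * (mean (fun x => (far v delta' N x)%:R) + mean (fun x => (out (state v K x))%:R)) <=
    2 * C * (3 * e1).
  by rewrite ler_wpM2l ?mulr_ge0//; lra.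
have : e1 * (1 + 8 * C) = e by rewrite /e1 divfK// gt_eqF.
have : 0 <= C * e1 by rewrite mulr_ge0// ltW.
lra.
Qed.

Lemma expectation_law (g : R -> R) (C : R) : measurable_fun [set: RR] (g : RR -> R) ->
  (forall t, `|g t| <= C) -> 'E_P[g \o Y]%E = (mean (fun x => g (v x)))%:E.
Proof.
move=> mg gC.
have mY : measurable_fun [set: Omega] (Y : Omega -> RR).
  by have : measurable_fun [set: Omega] Y by exact: measurable_funPT.
pose Z : {mfun Omega >-> RR} :=
  HB.pack (Y : Omega -> RR) (isMeasurableFun.Build _ _ _ _ _ mY).
have Poo : (P [set: Omega] < +oo)%E by rewrite probability_setT ltry.
pose PY : {measure set RR -> \bar R} := distribution P Z.
have bg : bmeas setT (g : RR -> R) by split=> //; exists C.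
have PYE : mean (fun x => g (v x)) = \int[PY]_(t in setT) g t.
  apply: (@Rintegral_transfer _ _ RR RR R mu PY X setT v _ _ mv mu_unit_itv_lty _ _ g bg) => //.
  by move=> A mA; rewrite setTI; exact: lawv.
have PY2 : \int[P]_(w in setT) g (Y w) = \int[PY]_(t in setT) g t.
  apply: (@Rintegral_transfer _ _ Omega RR R P PY setT setT Y _ _ mY Poo _ _ g bg) => //.
rewrite PYE -PY2 unlock /Rintegral fineK//.
apply: integrable_fin_num => //.
have bgY : bmeas setT (fun w => g (Y w)).
  by split; [exact: measurableT_comp|exists C => w _; exact: gC].
by apply: (bmeas_integrable _ _ bgY).
Qed.

Lemma spikes_strong_cvg : strong_cvg_in_distribution mu X `]0, +oo[
  (fun n x => (norming n%:R)^-1 * birkhoff_sum T (spikes v) n x) Y.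
Proof.
move=> Q QX Qmu g cg [C gC].
(* Extension by 0 makes the test function bounded and measurable on the whole line; it stays
   continuous at every positive point. *)
pose g' := g \_ `]0, +oo[%classic.
have mZ : measurable (`]0, +oo[%classic : set R) by exact: measurable_itv.
have mg' : measurable_fun [set: RR] (g' : RR -> R).
  have : measurable_fun setT (g' : R -> R).
    by apply/(measurable_restrictT _ mZ); exact: subspace_continuous_measurable_fun.
  by [].
have g'E t : 0 < t -> g' t = g t by move=> t0; rewrite /g' patchE mem_set//= in_itv/= t0.
have g'C t : `|g' t| <= `|C|.
  rewrite /g' patchE; case: ifPn => [/set_mem/gC/le_trans->//|_].
    exact: ler_norm.
  by rewrite normr0.
have cg' t : 0 < t -> {for t, continuous g'}.
  move=> t0.
  have oZ : open (`]0, +oo[%classic : set R) by exact: interval_open.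
  have ct : {for t, continuous g}.
    by move: cg; rewrite continuous_open_subspace// => /(_ t); apply; rewrite inE/= in_itv/= t0.
  rewrite /prop_for /continuous_at g'E//; apply: cvg_trans ct.
  apply: near_eq_cvg; near=> s; rewrite g'E//; near: s.
  exact: lt_nbhsr.
have [q [iq qQ]] := exists_density Qmu.
have mq : mean q = 1.
  have := qQ (fun=> 1) (bmeas_cst _ 1).
  have -> : (\int[Q]_(x in X) 1%:E = 1)%E by rewrite integral_cst// mul1e; exact: QX.
  by move=> [->]; apply: eq_mean => x _; rewrite mul1r.
have bn N : bmeas X (fun x => g' (normalized v N x)).
  split; last by exists `|C| => x _; exact: g'C.
  by apply: (measurableT_comp mg'); exact: measurable_normalized.
have bs N : bmeas X (fun x => g' (state v (@reference R N) x)).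
  by apply: (bmeas_state mv); split=> //; exists `|C|.
have inv N : block_invariant (@reference R N) (fun x => g' (state v (@reference R N) x)).
  by move=> x Xx px; rewrite block_invariant_state.
have -> : ('E_P[g \o Y] = 'E_P[g' \o Y])%E.
  by rewrite !unlock; apply: eq_integral => w _ /=; rewrite g'E.
rewrite (expectation_law mg' g'C).
have key e : 0 < e -> exists N0, forall N, (N0 <= N)%N ->
    `|mean (fun x => g' (normalized v N x) * q x) - mean (fun x => g' (v x))| <= e.
  move=> e0.
  have [N0 N0P] := mixing_density iq bn bs (fun _ _ => g'C _) (fun _ _ => g'C _) inv
    reference_large (normalized_close mg' g'C cg') (mean_state_limit mg' g'C) e0.
  by exists N0 => N /N0P; rewrite mq mulr1.
(* For n = 0 the sum is empty and the quotient is not positive, so [g] and [g'] may differ there. *)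
have eqint n : (0 < n)%N ->
    (\int[Q]_(x in X) (g ((norming n%:R)^-1 * birkhoff_sum T (spikes v) n x))%:E =
     (mean (fun x => g' (normalized v n x) * q x))%:E)%E.
  move=> n0; rewrite -(qQ _ (bn n)); apply: eq_integral => x _.
  have S0 : 0 < birkhoff_sum T (spikes v) n x.
    rewrite /birkhoff_sum -(prednK n0) big_ord_recl ltr_pwDl ?spikes_gt0//.
    by apply: sumr_ge0 => i _; rewrite ltW// spikes_gt0.
  rewrite g'E /normalized// ?mulr_gt0// ?invr_gt0 ?norming_gt0 ?ltr0n//.
apply: (cvg_trans (G := (mean (fun x => g' (normalized v n x) * q x))%:E @[n --> \oo])).
  by apply: near_eq_cvg; exists 1%N => // n /= n0; rewrite eqint.
apply: cvg_EFin; first by near=> n.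
apply/cvgrPdist_le => e e0; have [N0 N0P] := key e e0.
by exists N0 => // n /= /N0P; rewrite distrC.
Unshelve. all: by end_near.
Qed.

End Limit.

Theorem theorem1 (R : realType) (d : measure_display) (Omega : measurableType d)
    (P : probability Omega R) (Y : {RV P >-> R}) (Ypos : forall w, 0 < Y w) :
  exists (X : set R) (T : R -> R) (b : R -> R) (f : R -> R),
    [/\ is_odometer X T /\ lebesgue_measure X = 1%E,
        {in `]0, +oo[ &, {homo b : s t / s < t}} /\ regularly_varying 1 b,
        measurable_fun X f /\ (forall x, X x -> 0 < f x),
        strong_cvg_in_distribution lebesgue_measure X `]0, +oo[
          (fun n x => (b n%:R)^-1 * birkhoff_sum T f n x) Y &
        exists (M r : R) (N0 : nat),
          [/\ 1 < M, 0 < r, (1 <= N0)%N &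
              forall (x : R) (n : nat), 0 < x < r -> (N0 <= n)%N ->
              (lebesgue_measure
                 (X `&` [set w | (birkhoff_sum T f n w < x * b n%:R)%R])
               <= P [set w | (Y w <= M * x)%R])%E]].
Proof.
have [v [mv vpos lawv]] := exists_same_law Ypos.
exists unit_itv, (@odo R), norming, (spikes v); split.
- by split; [exact: odo_is_odometer|exact: mu_unit_itv].
- by split; [exact: norming_homo|exact: norming_regularly_varying].
- by split=> [|x _]; [exact: measurable_spikes|exact: spikes_gt0].
- exact: (spikes_strong_cvg Ypos mv vpos lawv).
have [N0 N0P] := birkhoff_lower_tail mv vpos lawv.
(* M is the constant of [birkhoff_lower]; r = 1 / M keeps M x below 1, hence below every cap. *)
exists 256, 256^-1, N0.+1; split.
- by rewrite ltr1n.
- by rewrite invr_gt0 ltr0n.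
- by [].
by move=> x n x0 hn; apply: N0P => //; exact: ltnW.
Qed.
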